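(* Let $d\in\mathbb{N}$ be arbitrary and let $\omega^{(1)},\dots,\omega^{(d)}$ be $d$ i.i.d. random environments with joint law $\mathsf{P}^{\otimes d}$, where each $\omega^{(i)}=(\omega^{(i)}_x)_{x\in\mathbb{Z}}$ has law $\mathsf{P}$. Under $\mathsf{P}$, an environment $\omega=(\omega_x)_{x\in\mathbb{Z}}$ is a sequence of i.i.d. random variables with values in $(0,1)$ such that, with $\rho_0:=\frac{1-\omega_0}{\omega_0}$: (i) $\mathsf{E}[\log\rho_0]=0$; (ii) $\mathsf{P}(\varepsilon\le\omega_0\le 1-\varepsilon)=1$ for some $\varepsilon\in(0,\tfrac12)$; (iii) $\mathsf{Var}(\log\rho_0)>0$. For fixed $\vec\omega:=(\omega^{(1)},\dots,\omega^{(d)})$, let $(X^{(i)}_n)_{n\in\mathbb{N}_0}$, $i=1,\dots,d$, be independent processes, where $(X^{(i)}_n)_{n\in\mathbb{N}_0}$ is a random walk in the environment $\omega^{(i)}$ started at $0$. Then, for $\mathsf{P}^{\otimes d}$-a.e. $\vec\omega$, the $d$-dimensional process $$\big(X^{(1)}_n,X^{(2)}_n,\dots,X^{(d)}_n\big)_{n\in\mathbb{N}_0}$$ is recurrent.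
   Context: $\mathbb{N}=\{1,2,\dots\}$, $\mathbb{N}_0=\mathbb{N}\cup\{0\}$. For a fixed environment $\omega\in(0,1)^{\mathbb{Z}}$, a random walk in the environment $\omega$ started at $0$ is the Markov chain $(X_n)_{n\in\mathbb{N}_0}$ on $\mathbb{Z}$ with $X_0=0$ and $P_\omega(X_{n+1}=y+1\mid X_n=y)=\omega_y=1-P_\omega(X_{n+1}=y-1\mid X_n=y)$ for all $y\in\mathbb{Z}$. For fixed $\vec\omega$ the $d$-dimensional process is a Markov chain on $\mathbb{Z}^d$ started at the origin; recurrent means that, with probability one (under the law for fixed $\vec\omega$), it returns to the origin $(0,\dots,0)$ infinitely often. *)

(* Defs.v *)
From HB Require Import structures.
From mathcomp Require Import all_boot all_order all_algebra finmap.
From mathcomp Require Import all_classical all_reals all_analysis.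

Set Implicit Arguments.
Unset Strict Implicit.
Unset Printing Implicit Defensive.

Import Order.TTheory GRing.Theory Num.Theory.
Import numFieldNormedType.Exports.

Local Open Scope classical_set_scope.
Local Open Scope ring_scope.

HB.instance Definition _ := isPointed.Build int 0.
HB.instance Definition _ := @isMeasurable.Build default_measure_display int
  discrete_measurable discrete_measurable0
  discrete_measurableC discrete_measurableU.

Definition mutually_independent (d : measure_display) (T : measurableType d)
    (R : realType) (P : probability T R) (I : choiceType)
    (F : I -> set (set T)) : Prop :=
  forall (J : {fset I}) (E : I -> set T),
    (forall i, i \in J -> F i (E i)) ->
    P (\bigcap_(i in [set` J]) E i) = (\prod_(i <- J) P (E i))%E.

Definition cond_prob (d : measure_display) (T : measurableType d)
    (R : realType) (P : probability T R) (A B : set T) : R :=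
  fine (P (A `&` B)) / fine (P B).

Definition cylinders (R : realType) : set (set (int -> R)) :=
  \bigcup_x preimage_set_system setT (fun w : int -> R => w x) measurable.

(* R^Z with its product sigma-algebra; the constraint that the values lie in
   ]0, 1[ is imposed on the law, in [iid_environment_law]. *)
Definition environment (R : realType) : Type :=
  g_sigma_algebraType (@cylinders R).

HB.instance Definition _ (R : realType) := Measurable.on (environment R).

Definition iid_environment_law (R : realType)
    (P : probability (environment R) R) : Prop :=
  [/\ P [set w : environment R | forall x, 0 < w x < 1] = 1%E,
      mutually_independent P (fun x : int =>
        preimage_set_system setT (fun w : environment R => w x) measurable) &
      forall (x : int) (B : set R), measurable B ->
        P [set w : environment R | B (w x)] =
        P [set w : environment R | B (w 0)]].

Definition rho (R : realType) (w : environment R) (x : int) : R :=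
  (1 - w x) / w x.

Definition is_product_law (d : measure_display) (T : measurableType d)
    (R : realType) (n : nat) (P : probability T R)
    (Pn : probability (n.-tuple T) R) : Prop :=
  forall A : 'I_n -> set T, (forall i, measurable (A i)) ->
    Pn [set t : n.-tuple T | forall i, A i (tnth t i)] =
    (\prod_(i < n) P (A i))%E.

Section walk.
Context (d : measure_display) (T : measurableType d) (R : realType).
Variable Q : probability T R.

Definition history (X : nat -> {RV Q >-> int}) (n : nat) (p : nat -> int) :
    set T :=
  [set t | forall k, (k <= n)%N -> X k t = p k].

Definition is_walk_in_environment (w : environment R)
    (X : nat -> {RV Q >-> int}) : Prop :=
  Q [set t | X 0%N t = 0] = 1%E /\
  forall (n : nat) (p : nat -> int), Q (history X n p) != 0%E ->
    cond_prob Q [set t | X n.+1 t = p n + 1] (history X n p) = w (p n) /\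
    cond_prob Q [set t | X n.+1 t = p n - 1] (history X n p) = 1 - w (p n).

Definition independent_processes (n : nat)
    (X : 'I_n -> nat -> {RV Q >-> int}) : Prop :=
  mutually_independent Q (fun i =>
    <<s \bigcup_k preimage_set_system setT (X i k) measurable >>).

Definition recurrent (n : nat) (X : 'I_n -> nat -> {RV Q >-> int}) : Prop :=
  {ae Q, forall t, infinite_set [set k : nat | forall i, X i k t = 0]}.

End walk.

(* Main.v *)
Require Import Defs.
From HB Require Import structures.
From mathcomp Require Import all_boot all_order all_algebra finmap.
From mathcomp Require Import all_classical all_reals all_analysis.
From mathcomp Require Import measurable_realfun ring lra zify.

(**
  Let [V] be the potential of an environment, with increments [ln rho]. Suppose
  that on both sides of the origin [V] climbs to height [L] before dropping
  below [- delta L], within a distance polynomial in [L]. The walk killed on leaving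
  this valley survives up to time of order [exp L] with probability at least
  1/2, because each visit to [0] leads to an exit with probability at most of
  order [exp (- L)]. Reversibility and Cauchy-Schwarz turn this into a return
  probability at least [exp (- 3 delta L)] at all even times up to that order.

  By optional stopping for [V] and [V^2], such a valley appears at scale [L]
  with probability bounded below uniformly in [L]. Choosing rapidly growing
  scales, the event at each scale can be made to depend only on sites not used
  by the smaller scales, since these sites only shift [V] by [O (delta L)]. The
  events are then independent across scales, and so is the event that all [d]
  environments have a valley at the same scale. By the second Borel-Cantelli
  lemma the latter happens infinitely often. With [delta = 1 / (6 d)], each such
  scale makes the sum over [n] of the product of the [d] return probabilities
  at least of order [exp (L / 2)], so the sum diverges, and the product chain is
  recurrent by decomposing according to the last visit to the origin.
*)

Set Implicit Arguments.
Unset Strict Implicit.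
Unset Printing Implicit Defensive.

Import Order.TTheory GRing.Theory Num.Theory.
Import numFieldNormedType.Exports.

Local Open Scope classical_set_scope.
Local Open Scope ring_scope.

(** * Heat kernel of a reversible walk killed outside an interval *)

Section step_operator.
Context (R : realType).
Implicit Types (w f g h c : int -> R) (x lo : int).

Definition step_op w f x : R := w x * f (x + 1) + (1 - w x) * f (x - 1).

(** The backward equation makes this the probability that the walk from 0 is at 0 at time [n],
    without reference to a probability space. *)
Definition return_prob w n : R := iter n (step_op w) (fun x => (x == 0)%R%:R) 0.

Definition killed_op w (lo : int) (K : nat) f x : R :=
  if lo <= x < lo + K%:Z then step_op w f x else 0.

(** Iterating [killed_op] on this function gives the probability of not having left the interval. *)
Definition interval_indic (lo : int) (K : nat) x : R :=
  (lo <= x < lo + K%:Z)%R%:R.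

Lemma le_step_op w f g : (forall x, 0 <= w x <= 1) ->
  (forall x, f x <= g x) -> forall x, step_op w f x <= step_op w g x.
Proof.
move=> w01 fg x; have /andP[w0 w1] := w01 x.
by rewrite /step_op lerD// ler_wpM2l// subr_ge0.
Qed.

Lemma step_op_ge0 w f : (forall x, 0 <= w x <= 1) ->
  (forall x, 0 <= f x) -> forall x, 0 <= step_op w f x.
Proof.
move=> w01 f0 x; have /andP[w0 w1] := w01 x.
by rewrite /step_op addr_ge0// mulr_ge0// subr_ge0.
Qed.

Lemma iter_step_op_ge0 w f n : (forall x, 0 <= w x <= 1) ->
  (forall x, 0 <= f x) -> forall x, 0 <= iter n (step_op w) f x.
Proof. by move=> w01 f0; elim: n => //= n IH; exact: step_op_ge0. Qed.

Lemma iter_killed_op_le w lo K f n : (forall x, 0 <= w x <= 1) ->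
  (forall x, 0 <= f x) ->
  forall x, iter n (killed_op w lo K) f x <= iter n (step_op w) f x.
Proof.
move=> w01 f0; elim: n => //= n IH x; rewrite /killed_op; case: ifP => _.
  exact: le_step_op.
by apply: step_op_ge0 => // y; exact: iter_step_op_ge0.
Qed.

Lemma iter_killed_op_out w lo K f n x : (forall x, ~~ (lo <= x < lo + K%:Z) -> f x = 0) ->
  ~~ (lo <= x < lo + K%:Z) -> iter n (killed_op w lo K) f x = 0.
Proof.
move=> f0 xI; case: n => [|n] /=; first exact: f0.
by rewrite /killed_op (negbTE xI).
Qed.

(* The probability of leaving the interval within [n] steps is at most
   [h + n * kappa]: the function [h] is superharmonic away from [0], and every
   visit to [0] costs at most [kappa]. *)
Lemma iter_killed_op_survival w lo K h (kappa : R) n :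
  (forall x, 0 <= w x <= 1) -> (forall x, 0 <= h x) -> 0 <= kappa ->
  1 <= h (lo - 1) -> 1 <= h (lo + K%:Z) ->
  (forall x, x != 0 -> step_op w h x <= h x) -> step_op w h 0 <= kappa ->
  forall x, lo - 1 <= x <= lo + K%:Z ->
  1 - h x - n%:R * kappa <= iter n (killed_op w lo K) (interval_indic lo K) x.
Proof.
move=> w01 h0 k0 hl hr hsup hk; elim: n => [|n IH] x xI.
  rewrite /= mul0r subr0 /interval_indic.
  case: (boolP (lo <= x < _)) => [_|xn]; first by rewrite lerBlDr lerDl.
  have [->|->] : x = lo - 1 \/ x = lo + K%:Z by lia.
  - by rewrite subr_le0.
  - by rewrite subr_le0.
rewrite iterS /killed_op; case: ifPn => [xin|xn]; last first.
  have nk : 0 <= n.+1%:R * kappa by rewrite mulr_ge0.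
  have [->|->] : x = lo - 1 \/ x = lo + K%:Z by lia.
  - lra.
  - lra.
have /andP[w0 w1] := w01 x.
have := IH (x + 1) ltac:(lia); have := IH (x - 1) ltac:(lia).
set a := iter _ _ _ (x - 1); set b := iter _ _ _ (x + 1) => Ha Hb.
have hx : step_op w h x <= h x + kappa.
  have [->|x0] := eqVneq x 0; first by rewrite (le_trans hk)// lerDr.
  by rewrite (le_trans (hsup _ x0))// lerDl.
have := ler_wpM2l w0 Hb; have : 0 <= 1 - w x by rewrite subr_ge0.
move=> /ler_wpM2l/(_ _ _ Ha); move: hx.
by rewrite /step_op -/a -/b -natr1; lra.
Qed.

(** The reversible measure, when [c x] is the conductance of the edge between [x] and [x + 1]. *)
Definition edge_measure c x : R := c x + c (x - 1).

Definition isum (lo : int) (K : nat) f : R := \sum_(i < K) f (lo + i%:Z).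

Lemma eq_isum lo K f g : (forall x, lo <= x < lo + K%:Z -> f x = g x) ->
  isum lo K f = isum lo K g.
Proof. by move=> fg; apply: eq_bigr => i _; apply: fg; case: i => i /=; lia. Qed.

Lemma isum_dirac lo K f x : lo <= x < lo + K%:Z ->
  isum lo K (fun y => f y * (y == x)%R%:R) = f x.
Proof.
move=> xI; have iK : (`|x - lo| < K)%N by lia.
have xE : lo + `|x - lo|%N%:Z = x by lia.
rewrite /isum (bigD1 (Ordinal iK))//= xE eqxx mulr1 big1 ?addr0// => i iN.
case: eqP => [E|_]; last by rewrite mulr0.
by case/eqP: iN; apply/val_inj => /=; lia.
Qed.

(** The [q]-weighted sum of the squares of [S * f - W] is nonnegative and equals
    [S * (S * F - W ^+ 2)]. *)
Lemma isum_cauchy_schwarz lo K (q f : int -> R) :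
  (forall x, 0 < q x) ->
  isum lo K (fun x => q x * f x) ^+ 2 <=
  isum lo K q * isum lo K (fun x => q x * f x ^+ 2).
Proof.
move=> q0; case: K => [|K]; first by rewrite /isum !big_ord0 expr0n mul0r.
set S := isum _ _ q; set W := isum _ _ (fun x => q x * f x); set F := isum _ _ _.
have S0 : 0 < S.
  rewrite /S /isum big_ord_recl ltr_pwDl//; apply: sumr_ge0 => i _.
  exact: ltW.
have : 0 <= isum lo K.+1 (fun x => q x * (S * f x - W) ^+ 2).
  by apply: sumr_ge0 => i _; rewrite mulr_ge0 ?sqr_ge0// ltW.
have -> s u : isum lo K.+1 (fun x => q x * (s * f x - u) ^+ 2) =
    s ^+ 2 * F - 2 * s * u * W + u ^+ 2 * S.
  transitivity (isum lo K.+1 (fun x => s ^+ 2 * (q x * f x ^+ 2)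
      + - (2 * s * u) * (q x * f x) + u ^+ 2 * q x)).
    by apply: eq_isum => x _; ring.
  by rewrite /isum !big_split/= -!mulr_sumr mulNr.
have -> : S ^+ 2 * F - 2 * S * W * W + W ^+ 2 * S = S * (S * F - W ^+ 2) by ring.
by rewrite pmulr_rge0// subr_ge0.
Qed.

(** * Reversible walks given by conductances *)

Section conductances.
Variables (w c : int -> R).
Hypothesis c_gt0 : forall x, 0 < c x.
Hypothesis wE : forall x, w x * edge_measure c x = c x.

Local Notation q := (edge_measure c).

Lemma edge_measure_gt0 x : 0 < q x. Proof. exact: addr_gt0. Qed.

Lemma edge_measureBw x : (1 - w x) * q x = c (x - 1).
Proof. by rewrite mulrBl wE mul1r /edge_measure addrAC subrr add0r. Qed.

Lemma conductance_w01 x : 0 <= w x <= 1.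
Proof.
rewrite -(pmulr_lge0 _ (edge_measure_gt0 x)) wE ltW//=.
by rewrite -subr_ge0 -(pmulr_lge0 _ (edge_measure_gt0 x)) edge_measureBw ltW.
Qed.

Lemma edge_measure_step_op f x :
  q x * step_op w f x = c x * f (x + 1) + c (x - 1) * f (x - 1).
Proof. by rewrite -(edge_measureBw x) -[X in X * f (x + 1)]wE /step_op; ring. Qed.

(** Either side is a sum over the edges inside the interval, symmetric in [f] and [g]; the two
    boundary edges contribute nothing because the functions vanish outside. *)
Lemma killed_op_selfadjoint lo K f g :
  (forall x, ~~ (lo <= x < lo + K%:Z) -> f x = 0) ->
  (forall x, ~~ (lo <= x < lo + K%:Z) -> g x = 0) ->
  isum lo K (fun x => q x * (killed_op w lo K f x * g x)) =
  isum lo K (fun x => q x * (f x * killed_op w lo K g x)).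
Proof.
case: K => [|K] f0 g0; first by rewrite /isum !big_ord0.
have half u v : (forall x, ~~ (lo <= x < lo + K.+1%:Z) -> u x = 0) ->
    (forall x, ~~ (lo <= x < lo + K.+1%:Z) -> v x = 0) ->
    isum lo K.+1 (fun x => q x * (killed_op w lo K.+1 u x * v x)) =
    \sum_(i < K) c (lo + i%:Z) * (v (lo + i%:Z) * u (lo + i%:Z + 1)
                                 + u (lo + i%:Z) * v (lo + i%:Z + 1)).
  move=> u0 v0; under eq_isum => x xI.
    rewrite /killed_op xI mulrA edge_measure_step_op mulrDl; over.
  rewrite /isum big_split/= big_ord_recr/= [X in _ + X]big_ord_recl/=.
  rewrite (u0 (lo + K%:Z + 1)) ?mulr0 ?mul0r ?addr0; last by lia.
  rewrite (u0 (lo - 1)) ?mulr0 ?mul0r ?add0r; last by lia.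
  rewrite -big_split/=; apply: eq_bigr => i _; rewrite /bump/=.
  have -> : lo + (1 + i)%N%:Z - 1 = lo + i%:Z by lia.
  have -> : lo + (1 + i)%N%:Z = lo + i%:Z + 1 by lia.
  ring.
rewrite half//.
under [RHS]eq_isum => x _ do rewrite (mulrC (f x)).
by rewrite half//; apply: eq_bigr => i _; ring.
Qed.

Lemma iter_killed_op_selfadjoint lo K f g n :
  (forall x, ~~ (lo <= x < lo + K%:Z) -> f x = 0) ->
  (forall x, ~~ (lo <= x < lo + K%:Z) -> g x = 0) ->
  isum lo K (fun x => q x * (iter n (killed_op w lo K) f x * g x)) =
  isum lo K (fun x => q x * (f x * iter n (killed_op w lo K) g x)).
Proof.
move=> f0; elim: n g => // n IH g g0; rewrite iterS killed_op_selfadjoint//.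
- by rewrite IH ?iterSr// => x /negbTE; rewrite /killed_op => ->.
- by move=> x; exact: iter_killed_op_out.
Qed.

(* Writing the return probability as the squared norm of [T^n delta_0], where
   [T] is the self-adjoint killed operator, and applying Cauchy-Schwarz against
   the constant function. *)
Lemma return_prob_ge_survival lo K n : lo <= 0 < lo + K%:Z ->
  q 0 * iter n (killed_op w lo K) (interval_indic lo K) 0 ^+ 2 / isum lo K q
  <= return_prob w n.*2.
Proof.
move=> I0; pose T := killed_op w lo K; pose d0 x : R := (x == 0)%R%:R.
have d0out x : ~~ (lo <= x < lo + K%:Z) -> d0 x = 0.
  by rewrite /d0; case: eqP => // -> /negP.
have iout x : ~~ (lo <= x < lo + K%:Z) -> interval_indic lo K x = 0.
  by rewrite /interval_indic => /negbTE ->.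
have w01 := conductance_w01.
apply: (@le_trans _ _ (iter n.*2 T d0 0)); last first.
  by apply: iter_killed_op_le => // x; rewrite /d0.
have q0 := edge_measure_gt0.
have S0 : 0 < isum lo K q.
  case: K I0 {T d0out iout} => [|K'] I0; first by lia.
  rewrite /isum big_ord_recl ltr_pwDl//; apply: sumr_ge0 => i _; exact: ltW.
rewrite ler_pdivrMr//.
have E1 : q 0 * iter n T (interval_indic lo K) 0 =
    isum lo K (fun x => q x * iter n T d0 x).
  transitivity (isum lo K (fun x => q x * (d0 x * iter n T (interval_indic lo K) x))).
    under eq_isum => x _ do rewrite mulrCA mulrC.
    by rewrite (isum_dirac (fun x => q x * iter n T (interval_indic lo K) x) I0).
  rewrite -iter_killed_op_selfadjoint//; apply: eq_isum => x xI.
  by rewrite /interval_indic xI mulr1.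
have E2 : q 0 * iter n.*2 T d0 0 = isum lo K (fun x => q x * iter n T d0 x ^+ 2).
  transitivity (isum lo K (fun x => q x * (iter n T (iter n T d0) x * d0 x))).
    under eq_isum => x _ do rewrite mulrA.
    rewrite (isum_dirac (fun x => q x * iter n T (iter n T d0) x) I0)//.
    by rewrite -iterD addnn.
  by rewrite iter_killed_op_selfadjoint// => x; exact: iter_killed_op_out.
rewrite -(ler_pM2l (q0 0)) mulrA -expr2 -exprMn E1 mulrA E2 mulrC.
exact: isum_cauchy_schwarz.
Qed.

(** On the interval, [h x] is the probability of leaving [[- m, M]] before hitting 0, a ratio of
    resistances. Keeping only the last resistance on each side gives the bound at 0. *)
Lemma exists_exit_barrier (m M : nat) : exists h : int -> R,
  [/\ forall x, 0 <= h x, h (- m%:Z - 1) = 1 /\ h (M%:Z + 1) = 1, h 0 = 0,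
      forall x, x != 0 -> step_op w h x = h x &
      step_op w h 0 <= (c M%:Z + c (- m%:Z - 1)) / q 0].
Proof.
pose r x := (c x)^-1.
pose A n := \sum_(i < n) r i%:Z; pose B n := \sum_(i < n) r (- i%:Z - 1).
have r0 x : 0 < r x by rewrite invr_gt0.
have A0 n : 0 <= A n by apply: sumr_ge0 => i _; exact: ltW.
have B0 n : 0 <= B n by apply: sumr_ge0 => i _; exact: ltW.
have AS n : A n.+1 = A n + r n%:Z by rewrite /A big_ord_recr.
have BS n : B n.+1 = B n + r (- n%:Z - 1) by rewrite /B big_ord_recr.
have AM : 0 < A M.+1 by rewrite AS ltr_wpDl.
have Bm : 0 < B m.+1 by rewrite BS ltr_wpDl.
have q0 := edge_measure_gt0.
have wr x : w x * r x = (q x)^-1.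
  by apply: (mulIf (lt0r_neq0 (q0 x))); rewrite mulrAC wE mulfV ?mulVf// lt0r_neq0.
have wr1 x : (1 - w x) * r (x - 1) = (q x)^-1.
  apply: (mulIf (lt0r_neq0 (q0 x))).
  by rewrite mulrAC edge_measureBw mulfV ?mulVf// lt0r_neq0.
(* [Negz n] is the site [- n.+1], hence the index [n.+1] of [B]. *)
pose h (x : int) := match x with
  | Posz n => A n / A M.+1 | Negz n => B n.+1 / B m.+1 end.
have hN n : h (- n%:Z) = B n / B m.+1.
  case: n => [|n]; last by rewrite -NegzE.
  by rewrite (_ : - 0%:Z = 0%:Z) // /h /A /B !big_ord0 !mul0r.
exists h; split.
- by move=> [n|n]; rewrite /h divr_ge0// ltW.
- split; first by rewrite (_ : - m%:Z - 1 = - m.+1%:Z) ?hN ?divff ?lt0r_neq0//; lia.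
  by rewrite (_ : M%:Z + 1 = M.+1%:Z) /h ?divff ?lt0r_neq0//; lia.
- by rewrite -[LHS]/(A 0%N / A M.+1) /A big_ord0 mul0r.
- move=> [[|n]|n] // _; rewrite /step_op.
    have -> : (n.+1%:Z + 1)%R = n.+2 by lia.
    have -> : (n.+1%:Z - 1)%R = n by lia.
    have := wr n.+1; have := wr1 n.+1.
    have -> : (n.+1%:Z - 1)%R = n by lia.
    move=> <- /(congr1 ( *%R^~ (A M.+1)^-1)); rewrite /h !AS.
    move: (w _) => u; move: (r n) (r n.+1) (_^-1) => r1 r2 a E.
    apply/eqP; rewrite -subr_eq0; move/eqP: E; rewrite -subr_eq0 => /eqP <-.
    apply/eqP; ring.
  rewrite !NegzE.
  have -> : (- n.+1%:Z + 1)%R = - n%:Z by lia.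
  have -> : (- n.+1%:Z - 1)%R = - n.+2%:Z by lia.
  have := wr (- n.+1%:Z); have := wr1 (- n.+1%:Z).
  move=> <- /(congr1 ( *%R^~ (B m.+1)^-1)); rewrite !hN !BS.
  have -> : (- n%:Z - 1)%R = - n.+1%:Z by lia.
  move: (w _) => u; move: (r _) (r _) (_^-1) => r1 r2 a E.
  apply/eqP; rewrite -subr_eq0; move/eqP: E; rewrite -subr_eq0 => /eqP E.
  by rewrite -oppr_eq0 -[X in _ == X]E; apply/eqP; ring.
- rewrite /step_op add0r sub0r (hN 1%N) -[h 1]/(A 1%N / A M.+1).
  rewrite /A /B !big_ord1 -/(A _) -/(B _) !mulrA wr oppr0 add0r.
  have := wr1 0; rewrite add0r => ->.
  rewrite -mulrDr mulrC ler_pM2r ?invr_gt0// lerD//.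
    rewrite -[leRHS]invrK lef_pV2 ?posrE ?invr_gt0//.
    by rewrite AS /r lerDr.
  rewrite -[leRHS]invrK lef_pV2 ?posrE ?invr_gt0//.
  by rewrite BS /r lerDr.
Qed.

(** The hypothesis and the exit barrier bound the probability of leaving [[- m, M]] within [n] steps
    by 1/2; the squared survival probability is then at least 1/4. *)
Lemma return_prob_ge (m M n : nat) :
  n%:R * (c M%:Z + c (- m%:Z - 1)) <= q 0 / 2 ->
  q 0 / (4 * isum (- m%:Z) (m + M).+1 q) <= return_prob w n.*2.
Proof.
move=> small; have [h [h0 [hl hr] h00 hsup hk]] := exists_exit_barrier m M.
have I0 : - m%:Z <= 0 < - m%:Z + (m + M).+1%:Z by lia.
apply: le_trans (return_prob_ge_survival n I0).
have q0 := edge_measure_gt0.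
set kappa := (c M%:Z + _) / q 0 in hk.
have k0 : 0 <= kappa by rewrite divr_ge0 ?addr_ge0// ltW.
have rE : - m%:Z + (m + M).+1%:Z = M%:Z + 1 by lia.
have := @iter_killed_op_survival w (- m%:Z) (m + M).+1 h kappa n conductance_w01
  h0 k0.
rewrite rE hl hr => /(_ (lexx _) (lexx _)).
have hle x : x != 0 -> step_op w h x <= h x by move=> /hsup ->.
move=> /(_ hle hk 0 ltac:(lia)).
rewrite h00 subr0; set s := iter _ _ _ _ => sge.
have s2 : 2^-1 <= s.
  apply: le_trans sge; suff : n%:R * kappa <= 2^-1 by lra.
  by rewrite /kappa mulrA ler_pdivrMr// [leRHS]mulrC.
have S0 : 0 < isum (- m%:Z) (m + M).+1 q.
  by rewrite /isum big_ord_recl ltr_pwDl//; apply: sumr_ge0 => i _; exact: ltW.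
rewrite invfM mulrA ler_pM2r ?invr_gt0// ler_pM2l//.
rewrite (_ : 4^-1 = 2^-1 ^+ 2) ?lerXn2r ?nnegrE//; last first.
  by rewrite exprVn; congr (_^-1); ring.
by rewrite (le_trans _ s2).
Qed.

End conductances.
End step_operator.

(** * Product of independent walks *)

Section joint_walk.
Context (disp : measure_display) (T : measurableType disp) (R : realType).
Variable Q : probability T R.

Definition pr (A : set T) : R := fine (Q A).

Lemma prE A : measurable A -> Q A = (pr A)%:E.
Proof. by move=> mA; rewrite /pr fineK// fin_num_measure. Qed.

Lemma pr_ge0 A : 0 <= pr A.
Proof. exact: fine_ge0. Qed.

Lemma pr_le A B : measurable A -> measurable B -> A `<=` B -> pr A <= pr B.
Proof.
by move=> mA mB AB; rewrite -lee_fin -!prE//; apply: le_measure; rewrite ?inE.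
Qed.

Lemma pr_le1 A : measurable A -> pr A <= 1.
Proof. by move=> mA; rewrite -lee_fin -prE// probability_le1. Qed.

Lemma pr_setID A B : measurable A -> measurable B ->
  pr A = pr (A `&` B) + pr (A `\` B).
Proof.
move=> mA mB; apply: EFin_inj; rewrite EFinD -!prE//.
- by rewrite addeC; apply: measureDI.
- exact: measurableD.
- exact: measurableI.
Qed.

Lemma pr_bigcup_fin (I : finType) (F : I -> set T) :
  (forall i, measurable (F i)) -> trivIset setT F ->
  pr (\bigcup_i F i) = \sum_i pr (F i).
Proof.
move=> mF tF; rewrite /pr measure_fin_bigcup//; last exact: finite_finset.
have -> : [set: I] = [set` index_enum I].
  by apply/seteqP; split=> i //= _; rewrite mem_index_enum.
rewrite -fsbig_seq ?index_enum_uniq// -sum_fine// => i _; exact: fin_num_measure.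
Qed.

Lemma measurable_walk_eq (X : {RV Q >-> int}) (a : int) :
  measurable [set t | X t = a].
Proof. by rewrite -[X in measurable X]setTI; exact: (measurable_funP X _ [set a]). Qed.

Definition unit_step (b : bool) : int := if b then 1 else -1.

Definition trans (w : int -> R) (x : int) (b : bool) : R :=
  if b then w x else 1 - w x.

(** * Histories of a single walk *)

Section one_walk.
Variables (w : environment R) (X : nat -> {RV Q >-> int}).
Hypothesis Xw : is_walk_in_environment w X.

Lemma historyE n p :
  history X n p = \bigcap_(k < n.+1) [set t | X k t = p k].
Proof. by apply/seteqP; split. Qed.

Lemma measurable_history n p : measurable (history X n p).
Proof.
by rewrite historyE; apply: bigcap_measurableType => // k _; exact: measurable_walk_eq.
Qed.

Lemma history_sigma n p :
  <<s \bigcup_k preimage_set_system setT (X k) measurable >> (history X n p).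
Proof.
rewrite historyE.
set G := \bigcup_k _; pose T' := g_sigma_algebraType G.
apply: (@bigcap_measurableType _ T') => // k _.
apply: sub_gen_smallest; exists k => //; exists [set p k] => //.
by rewrite setTI.
Qed.

Lemma history_eq n p p' : (forall k, (k <= n)%N -> p k = p' k) ->
  history X n p = history X n p'.
Proof. by move=> pp; apply/seteqP; split=> t Ht k kn; rewrite Ht// pp. Qed.

Lemma historyS n p :
  history X n.+1 p = [set t | X n.+1 t = p n.+1] `&` history X n p.
Proof.
apply/seteqP; split=> [t Ht|t [Hn Ht] k]; first by split=> [|k kn]; apply: Ht; lia.
by rewrite leq_eqVlt => /predU1P[->//|]; exact: Ht.
Qed.

Lemma pr_historyS n p b : p n.+1 = p n + unit_step b ->
  pr (history X n.+1 p) = pr (history X n p) * trans w (p n) b.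
Proof.
move=> pE; have mH := measurable_history n p.
(* The transition rule says nothing about null histories; for these both sides are 0. *)
have [H0|H0] := eqVneq (Q (history X n p)) 0%E.
  rewrite {2}/pr H0 mul0r; apply/eqP; rewrite eq_le pr_ge0 andbT.
  rewrite -[leRHS](_ : pr (history X n p) = 0); last by rewrite /pr H0.
  by apply: pr_le => //; [exact: measurable_history|rewrite historyS; exact: subIsetr].
have [_ /(_ _ _ H0)[]] := Xw.
have pH : pr (history X n p) != 0 by rewrite /pr fine_eq0// fin_num_measure.
rewrite /cond_prob -/(pr _) -/(pr _) historyS pE /trans.
case: b {pE} => /= [<- _|_ <-].
  by rewrite mulrC divfK.
by rewrite mulrC divfK.
Qed.

Lemma pr_history0 : pr (history X 0 (fun=> 0)) = 1.
Proof.
have [X0 _] := Xw; rewrite /pr (_ : history _ _ _ = [set t | X 0%N t = 0]) ?X0//.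
by apply/seteqP; split=> [t /(_ 0%N isT)//|t X0t k]; rewrite leqn0 => /eqP ->.
Qed.

End one_walk.

(** * Markov property and last visits of the joint walk *)

Section several_walks.
Variables (d : nat) (w : 'I_d -> environment R) (X : 'I_d -> nat -> {RV Q >-> int}).
Hypothesis Xw : forall i, is_walk_in_environment (w i) (X i).
Hypothesis Xindep : independent_processes X.
Implicit Types (p : 'I_d -> nat -> int) (z : 'I_d -> int).
Implicit Types (B : pred ('I_d -> int)) (s : seq (pred ('I_d -> int))).

Definition jhistory n p : set T := \bigcap_i history (X i) n (p i).

Definition extend n p (e : {ffun 'I_d -> bool}) i k : int :=
  if k == n.+1 then p i n + unit_step (e i) else p i k.

Definition displace z (e : {ffun 'I_d -> bool}) i : int := z i + unit_step (e i).

Definition jtrans z (e : {ffun 'I_d -> bool}) : R := \prod_i trans (w i) (z i) (e i).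

Definition position n t i : int := X i n t.

(* Probability that the joint walk started at [z] satisfies the predicates of [s]
   at its successive positions. *)
Fixpoint path_weight s z : R := if s is B :: s' then
    \sum_e jtrans z e * (if B (displace z e) then path_weight s' (displace z e) else 0)
  else 1.

(** The event whose conditional probability, given the joint history up to time [n], is
    [path_weight s]. *)
Definition future n s : set T :=
  [set t | forall j, (j < size s)%N -> nth xpredT s j (position (n.+1 + j) t)].

Lemma measurable_jhistory n p : measurable (jhistory n p).
Proof.
by apply: fin_bigcap_measurable => // i _; exact: measurable_history.
Qed.

Lemma pr_jhistory n p : pr (jhistory n p) = \prod_i pr (history (X i) n (p i)).
Proof.
have := Xindep (J := [fset i in 'I_d]%fset) (E := fun i => history (X i) n (p i)).
have -> : [set` [fset i in 'I_d]%fset] = [set: 'I_d].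
  by apply/seteqP; split=> i //= _; rewrite !inE.
rewrite -/(jhistory n p) => E; apply: EFin_inj.
rewrite -prE; last exact: measurable_jhistory.
rewrite E; last by move=> i _; exact: history_sigma.
rewrite (perm_big (index_enum 'I_d)); last first.
  apply: uniq_perm; rewrite ?index_enum_uniq ?fset_uniq// => i.
  by rewrite mem_index_enum !inE.
rewrite -prodEFin; apply: eq_bigr => i _; rewrite prE//.
exact: measurable_history.
Qed.

Lemma pr_jhistory_extend n p e :
  pr (jhistory n.+1 (extend n p e)) = pr (jhistory n p) * jtrans (p ^~ n) e.
Proof.
rewrite !pr_jhistory -big_split; apply: eq_bigr => i _ /=.
rewrite (pr_historyS (Xw i) (b := e i)).
  congr (_ * trans _ _ _); last by rewrite /extend ltn_eqF.
  by congr pr; apply: history_eq => k kn; rewrite /extend ltn_eqF.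
by rewrite /extend eqxx ltn_eqF.
Qed.

Lemma jtrans_sum1 z : \sum_e jtrans z e = 1.
Proof.
rewrite /jtrans -(bigA_distr_bigA (fun i => trans (w i) (z i))).
by rewrite big1// => i _; rewrite big_bool /trans/= addrC subrK.
Qed.

(** The walks take unit steps only almost surely. The disjoint one-step extensions exhaust a history
    up to a null set, since their probabilities add up to that of the history. *)
Lemma pr_jhistory_split n p F : measurable F ->
  pr (jhistory n p `&` F) = \sum_e pr (jhistory n.+1 (extend n p e) `&` F).
Proof.
move=> mF; pose G e := jhistory n.+1 (extend n p e).
have mG e : measurable (G e) by exact: measurable_jhistory.
have GF (H : set T) : measurable H ->
    pr (\bigcup_e G e `&` H) = \sum_e pr (G e `&` H).
  move=> mH; rewrite setI_bigcupl pr_bigcup_fin//.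
    by move=> e; exact: measurableI.
  apply/trivIsetP => e e' _ _ /eqP ee'; apply/seteqP; split=> // t.
  move=> [[Ge _] [Ge' _]]; apply: ee'; apply/ffunP => i.
  have := Ge i I n.+1 (leqnn _); rewrite (Ge' i I n.+1 (leqnn _)).
  by rewrite /extend !eqxx => /addrI; case: (e i) (e' i) => [] [].
have mU : measurable (\bigcup_e G e).
  exact: fin_bigcup_measurable.
have mJ := measurable_jhistory n p.
have GJ : \bigcup_e G e `<=` jhistory n p.
  move=> t [e _ Ge] i _ k kn; have := Ge i I k (leqW kn).
  by rewrite /extend ltn_eqF.
have null : pr (jhistory n p `\` \bigcup_e G e) = 0.
  have := pr_setID mJ mU; rewrite (setIidr GJ) -[X in pr X + _]setIT GF//.
  under eq_bigr => e _ do rewrite setIT pr_jhistory_extend.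
  rewrite -mulr_sumr jtrans_sum1 mulr1 => /eqP.
  by rewrite addrC -subr_eq subrr eq_sym => /eqP.
rewrite (pr_setID (measurableI _ _ mJ mF) mU) setIAC (setIidr GJ).
rewrite GF// [X in _ + X](_ : _ = 0) ?addr0//.
apply/eqP; rewrite eq_le pr_ge0 andbT -null; apply: pr_le.
- by apply: measurableD => //; exact: measurableI.
- exact: measurableD.
- by move=> t [[]].
Qed.

Lemma measurable_at n B : measurable [set t | B (position n t)].
Proof.
pose F (z : {ffun 'I_d -> int}) := \bigcap_i [set t | X i n t = z i].
(* Joint positions are coded as finite functions, whose type is countable. *)
rewrite (_ : [set t | _] = \bigcup_(z : {ffun 'I_d -> int})
    if B z then F z else set0); last first.
  apply/seteqP; split=> t.
    move=> /= Bt; exists [ffun i => position n t i] => //=.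
    have -> : [ffun i => position n t i] = position n t :> ('I_d -> int).
      by apply/funext => i; rewrite ffunE.
    by rewrite Bt => i _ /=; rewrite ffunE.
  move=> [z _]; case: ifPn => // Bz Ft /=.
  suff -> : position n t = z by [].
  by apply/funext => i; exact: Ft.
apply: countable_bigcupT_measurable => // z; case: ifP => // _.
by apply: fin_bigcap_measurable => // i _; exact: measurable_walk_eq.
Qed.

Lemma measurable_future n s : measurable (future n s).
Proof.
rewrite (_ : future n s = \bigcap_(j < size s)
  [set t | nth xpredT s j (position (n.+1 + j) t)]); last by apply/seteqP; split.
by apply: bigcap_measurableType => // j _; exact: measurable_at.
Qed.

Lemma future_cons n B s :
  future n (B :: s) = [set t | B (position n.+1 t)] `&` future n.+1 s.
Proof.
apply/seteqP; split=> t.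
  move=> Ht; split; first by have := Ht 0%N isT; rewrite addn0.
  by move=> j js; have := Ht j.+1 js; rewrite addnS.
by move=> [B0 Ht] [_|j js]; [rewrite addn0|rewrite addnS; exact: Ht].
Qed.

(** Markov property of the joint walk, by splitting the history according to its next step. *)
Lemma pr_jhistory_future n p s :
  pr (jhistory n p `&` future n s) = pr (jhistory n p) * path_weight s (p ^~ n).
Proof.
elim: s n p => [|B s IH] n p /=.
  by rewrite mulr1 (_ : future n [::] = setT) ?setIT//; apply/seteqP; split.
rewrite pr_jhistory_split; last exact: measurable_future.
rewrite mulr_sumr; apply: eq_bigr => e _; rewrite mulrA -pr_jhistory_extend.
have posE t : jhistory n.+1 (extend n p e) t -> position n.+1 t = displace (p ^~ n) e.
  move=> Ht; apply/funext => i; rewrite /position (Ht i I n.+1 (leqnn _)).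
  by rewrite /extend eqxx.
have mvE : extend n p e ^~ n.+1 = displace (p ^~ n) e.
  by apply/funext => i; rewrite /extend eqxx.
case: ifPn => Be.
  rewrite -mvE -IH future_cons; congr pr; apply/seteqP; split=> t.
    by move=> [? []].
  by move=> [Ht Hf]; split=> //; split=> //=; rewrite posE.
rewrite mulr0 (_ : _ `&` _ = set0) ?/pr ?measure0//.
apply/seteqP; split=> // t [Ht]; rewrite future_cons => -[/=].
by rewrite posE// (negbTE Be).
Qed.

Lemma pr_future0 s : pr (future 0 s) = path_weight s (fun=> 0).
Proof.
have J1 : pr (jhistory 0 (fun _ _ => 0)) = 1.
  by rewrite pr_jhistory big1// => i _; rewrite (pr_history0 (Xw i)).
have mF := measurable_future 0 s; have mJ := measurable_jhistory 0 (fun _ _ => 0).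
have := pr_jhistory_future 0 (fun _ _ => 0) s; rewrite J1 mul1r => <-.
rewrite (pr_setID mF mJ) setIC [X in _ + X](_ : _ = 0) ?addr0//.
apply/eqP; rewrite eq_le pr_ge0 andbT.
have : pr (~` jhistory 0 (fun _ _ => 0)) = 0.
  apply: EFin_inj; rewrite -prE; last exact: measurableC.
  by rewrite probability_setC// prE// J1 subee.
move=> <-; apply: pr_le; [exact: measurableD|exact: measurableC|by move=> t []].
Qed.

Definition at0 z := [forall i, z i == 0].

Lemma at0E z : at0 z -> z = fun=> 0.
Proof. by move=> /forallP z0; apply/funext => i; exact/eqP. Qed.

(** Renewal: a forced visit to the origin restarts the chain there. *)
Lemma path_weight_cat_at0 s1 s2 z :
  path_weight (s1 ++ at0 :: s2) z = path_weight (rcons s1 at0) z * path_weight s2 (fun=> 0).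
Proof.
elim: s1 z => [|B s1 IH] z /=; rewrite mulr_suml; apply: eq_bigr => e _.
  by case: ifPn => [/at0E->|]; rewrite ?mulr1 ?mulr0 ?mul0r.
by case: ifPn => _; rewrite ?IH ?mulr0 ?mul0r// mulrA.
Qed.

(** With no constraint before the last time the coordinates decouple: the sum over joint steps of a
    product is a product of sums, one [step_op] per coordinate. *)
Lemma path_weight_return n z : path_weight (rcons (nseq n xpredT) at0) z =
  \prod_i iter n.+1 (step_op (w i)) (fun x => (x == 0)%R%:R) (z i).
Proof.
elim: n z => [|n IH] z /=.
  under eq_bigr => e _.
    rewrite (_ : (if at0 _ then 1 else 0) =
        \prod_i (displace z e i == 0)%R%:R :> R); last first.
      case: ifPn => [/forallP z0|]; first by rewrite big1// => i _; rewrite z0.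
      rewrite negb_forall => /existsP[i /negbTE ei]; rewrite (bigD1 i)//= ei mul0r//.
    rewrite /jtrans -big_split/=; over.
  rewrite -(bigA_distr_bigA (fun i b => trans (w i) (z i) b
     * (z i + unit_step b == 0)%R%:R)).
  by apply: eq_bigr => i _; rewrite big_bool.
under eq_bigr => e _ do rewrite IH /jtrans -big_split/=.
rewrite -(bigA_distr_bigA (fun i b => trans (w i) (z i) b
   * iter n.+1 (step_op (w i)) (fun x => (x == 0)%R%:R) (z i + unit_step b))).
by apply: eq_bigr => i _; rewrite big_bool.
Qed.

Definition off0 z := ~~ at0 z.

Definition no_visit n M : set T :=
  [set t | forall j, (j < M)%N -> off0 (position (n.+1 + j) t)].

Lemma future_off0 n M : future n (nseq M off0) = no_visit n M.
Proof.
by apply/seteqP; split=> t Ht j; rewrite ?size_nseq => jM;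
  have := Ht j; rewrite ?size_nseq nth_nseq jM => /(_ isT).
Qed.

Lemma future_xpredT n k s : future n (nseq k xpredT ++ s) = future (n + k) s.
Proof.
elim: k n => [|k IH] n /=; first by rewrite addn0.
rewrite future_cons IH addSnnS (_ : [set t | _] = setT) ?setTI//.
by apply/seteqP; split.
Qed.

Definition last_visit n M : set T :=
  [set t | at0 (position n.+1 t)] `&` no_visit n.+1 M.

Lemma measurable_no_visit n M : measurable (no_visit n M).
Proof. by rewrite -future_off0; exact: measurable_future. Qed.

Lemma measurable_last_visit n M : measurable (last_visit n M).
Proof. by apply: measurableI; [exact: measurable_at|exact: measurable_no_visit]. Qed.

Lemma pr_last_visit n M : pr (last_visit n M) =
  (\prod_i return_prob (w i) n.+1) * pr (no_visit 0 M).
Proof.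
rewrite -future_off0 pr_future0 -[X in X * _](path_weight_return n (fun=> 0)).
rewrite -path_weight_cat_at0.
by rewrite -pr_future0 future_xpredT add0n future_cons future_off0.
Qed.

Lemma no_visit_anti n M N : (M <= N)%N -> no_visit n N `<=` no_visit n M.
Proof. by move=> MN t Ht j jM; apply: Ht; exact: leq_trans MN. Qed.

(* Decomposition according to the last visit to the origin before time [N]. *)
Lemma pr_no_visit_sum_le1 N :
  pr (no_visit 0 N) * \sum_(n < N) \prod_i return_prob (w i) n.+1 <= 1.
Proof.
(* [F n] says that the last visit among the times 1 to [N] is at time [n.+1]. *)
pose F (n : 'I_N) := last_visit n (N - n.+1).
have mF n : measurable (F n) by exact: measurable_last_visit.
have tF : trivIset setT F.
  have disj (n m : 'I_N) : (n < m)%N -> F n `&` F m = set0.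
    move=> nm; apply/seteqP; split=> // t [[_ Hn] [Hm _]].
    have := Hn (m - n.+1)%N; rewrite ltn_sub2rE//.
    rewrite (_ : (n.+2 + (m - n.+1))%N = m.+1); last by lia.
    by rewrite /off0 Hm => /(_ (ltn_ord m)).
  apply/trivIsetP => n m _ _ nm; case: (ltngtP n m) => [|mn|/val_inj E].
  - exact: disj.
  - by rewrite setIC; exact: disj.
  - by rewrite E eqxx in nm.
apply: (@le_trans _ _ (pr (\bigcup_n F n))); last first.
  by apply: pr_le1; exact: fin_bigcup_measurable.
rewrite pr_bigcup_fin// mulr_sumr; apply: ler_sum => n _.
rewrite pr_last_visit mulrC.
(* This product is the probability of [last_visit n 0]. *)
have u0 : 0 <= \prod_i return_prob (w i) n.+1.
  have := pr_last_visit n 0; rewrite (_ : no_visit 0 0 = setT).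
    by rewrite /pr probability_setT mulr1 -/(pr _) => <-; exact: pr_ge0.
  by apply/seteqP; split=> // t _ j.
rewrite ler_wpM2l//; apply: pr_le; [exact: measurable_no_visit..|].
by apply: no_visit_anti; lia.
Qed.

(** A divergent sum forces the probability of never returning to be 0. By renewal, a last visit at
    any given time is then a null event, and a path with finitely many visits has a last one. *)
Lemma recurrent_of_unbounded_sum :
  (forall K : R, exists N, K <= \sum_(n < N) \prod_i return_prob (w i) n.+1) ->
  recurrent X.
Proof.
move=> unb.
have small (eps : R) : 0 < eps -> exists N, pr (no_visit 0 N) <= eps.
  move=> e0; have [N HN] := unb eps^-1; exists N.
  have := pr_no_visit_sum_le1 N; rewrite -ler_pdivlMr; last first.
    by apply: lt_le_trans HN; rewrite invr_gt0.
  move=> /le_trans; apply; rewrite div1r -[leRHS]invrK lef_pV2 ?posrE ?invr_gt0//.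
  by apply: lt_le_trans HN; rewrite invr_gt0.
pose never n : set T := [set t | at0 (position n t)] `&`
  \bigcap_M no_visit n M.
have mnever n : measurable (never n).
  apply: measurableI; first exact: measurable_at.
  by apply: bigcapT_measurable => M; exact: measurable_no_visit.
have never0 n : Q (never n) = 0%E.
  rewrite prE//; congr (_%:E); apply/eqP; rewrite eq_le pr_ge0 andbT.
  apply/ler_addgt0Pl => eps e0; rewrite addr0; have [M HM] := small _ e0.
  apply: le_trans HM; case: n => [|n].
    apply: pr_le => //; first exact: measurable_no_visit.
    by move=> t [_ /(_ M I)].
  apply: (@le_trans _ _ (pr (last_visit n M))).
    apply: pr_le => //; first exact: measurable_last_visit.
    by move=> t [? /(_ M I)].
  have := pr_last_visit n M; have := pr_last_visit n 0.
  rewrite (_ : no_visit 0 0 = setT); last by apply/seteqP; split=> // t _ j.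
  rewrite {2}/pr probability_setT mulr1 => <- ->.
  by rewrite ler_piMl ?pr_ge0// pr_le1//; exact: measurable_last_visit.
(* Almost surely time 0 is a visit, so a finite set of visits has a maximum. *)
pose bad0 := ~` [set t | at0 (position 0 t)].
have bad00 : Q bad0 = 0%E.
  have m0 := measurable_at 0 at0.
  rewrite probability_setC// prE// (_ : pr _ = 1) ?subee//.
  have := pr_jhistory 0 (fun _ _ => 0).
  rewrite big1 => [<-|i _]; last by rewrite (pr_history0 (Xw i)).
  congr pr; apply/seteqP; split=> t.
    by move=> /forallP t0 i _ k; rewrite leqn0 => /eqP ->; exact/eqP/t0.
  by move=> Ht; apply/forallP => i; apply/eqP; apply: (Ht i I 0%N).
have neg : Q.-negligible (bad0 `|` \bigcup_n never n).
  apply: negligibleU; last apply: negligible_bigcup => n.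
    by apply/negligibleP => //; apply: measurableC; exact: measurable_at.
  by apply/negligibleP; [exact: mnever|exact: never0].
apply: negligibleS neg => t /= fin.
apply: contrapT => /not_orP[/contrapT t0 nev]; apply: fin => /finite_fsetP[A AE].
have AP k : at0 (position k t) = (k \in A).
  apply/idP/idP => [/forallP kt|kA].
    by have : [set` A] k by rewrite -AE => i; exact/eqP/kt.
  have : [set k : nat | forall i, X i k t = 0] k by rewrite AE.
  by move=> kt; apply/forallP => i; exact/eqP/kt.
have bnd k : at0 (position k t) -> (k <= \max_(j <- A) j)%N.
  by rewrite AP => kA; exact: leq_bigmax_seq.
have ex0 : exists k, at0 (position k t) by exists 0%N.
case: (ex_maxnP ex0 bnd) => m tm mmax; apply: nev.
exists m => //; split=> // M _ j _; apply/negP => /mmax; lia.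
Qed.

End several_walks.
End joint_walk.

(** * Expectation of bounded random variables *)

Section bounded_expectation.
Context (disp : measure_display) (T : measurableType disp) (R : realType).
Variable P : probability T R.
Implicit Types f g : T -> R.

(** A class of integrable functions closed under sums and products, on which [Ex] is linear. *)
Definition bmeas f := measurable_fun setT f /\ exists M : R, forall t, `|f t| <= M.

Definition Ex f : R := \int[P]_t f t.

Definition indep_pair f g := forall A B : set R, measurable A -> measurable B ->
  P ((f @^-1` A) `&` (g @^-1` B)) = (P (f @^-1` A) * P (g @^-1` B))%E.

Lemma bmeas_integrable f : bmeas f -> P.-integrable setT (EFin \o f).
Proof.
move=> [mf [M fM]]; apply: measurable_bounded_integrable => //.
  exact: le_lt_trans (probability_le1 _ _) (ltry _).
by exists M; split; [exact: num_real|move=> x Mx t _; exact: le_trans (ltW Mx)].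
Qed.

Lemma bmeasD f g : bmeas f -> bmeas g -> bmeas (fun t => f t + g t).
Proof.
move=> [mf [M fM]] [mg [N gN]]; split; first exact: measurable_funD.
by exists (M + N) => t; rewrite (le_trans (ler_normD _ _))// lerD.
Qed.

Lemma bmeasM f g : bmeas f -> bmeas g -> bmeas (fun t => f t * g t).
Proof.
move=> [mf [M fM]] [mg [N gN]]; split; first exact: measurable_funM.
by exists (M * N) => t; rewrite normrM ler_pM.
Qed.

Lemma bmeas_cst (a : R) : bmeas (fun=> a).
Proof. by split; [exact: measurable_cst|exists `|a|]. Qed.

Lemma ExD f g : bmeas f -> bmeas g -> Ex (fun t => f t + g t) = Ex f + Ex g.
Proof. by move=> bf bg; rewrite /Ex RintegralD//; exact: bmeas_integrable. Qed.

Lemma ExZ (a : R) f : bmeas f -> Ex (fun t => a * f t) = a * Ex f.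
Proof. by move=> bf; rewrite /Ex RintegralZl//; exact: bmeas_integrable. Qed.

Lemma Ex_cst (a : R) : Ex (fun=> a) = a.
Proof.
rewrite /Ex Rintegral_cst//; transitivity (a * fine (P setT)) => //.
by rewrite probability_setT mulr1.
Qed.

Lemma Ex_le f g : bmeas f -> bmeas g -> (forall t, f t <= g t) -> Ex f <= Ex g.
Proof.
by move=> bf bg fg; apply: le_Rintegral => //; exact: bmeas_integrable.
Qed.

Lemma Ex_indic A : measurable A -> Ex (\1_A) = fine (P A).
Proof. by move=> mA; rewrite /Ex /Rintegral integral_indic// setIT. Qed.

Lemma bmeas_indic A : measurable A -> bmeas (\1_A).
Proof.
move=> mA; split; first exact: measurable_indic.
by exists 1 => t; rewrite indicE; case: (_ \in _); rewrite ?normr1 ?normr0.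
Qed.

Lemma indep_pair_comp f g (u v : R -> R) :
  measurable_fun setT u -> measurable_fun setT v -> indep_pair f g ->
  indep_pair (u \o f) (v \o g).
Proof.
move=> mu mv fg A B mA mB; apply: (fg (u @^-1` A) (v @^-1` B)).
  by rewrite -[X in measurable X]setTI; exact: mu.
by rewrite -[X in measurable X]setTI; exact: mv.
Qed.

(** Independence says that the law of the pair agrees with the product of the marginal laws on
    rectangles, hence everywhere; Fubini concludes. *)
Lemma Ex_indepM f g : bmeas f -> bmeas g -> indep_pair f g ->
  Ex (fun t => f t * g t) = Ex f * Ex g.
Proof.
move=> bf bg fg; have [mf _] := bf; have [mg _] := bg.
pose F : {mfun T >-> R} := HB.pack f (isMeasurableFun.Build _ _ _ _ f mf).
pose G : {mfun T >-> R} := HB.pack g (isMeasurableFun.Build _ _ _ _ g mg).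
pose phi t := (f t, g t).
have mphi : measurable_fun setT phi by exact: measurable_fun_pair.
pose H : {mfun T >-> (R * R)%type} := HB.pack phi (isMeasurableFun.Build _ _ _ _ phi mphi).
pose m1 := distribution P F; pose m2 := distribution P G; pose m := distribution P H.
pose k (z : R * R) := (z.1 * z.2)%:E.
have mk : measurable_fun setT k.
  by apply/measurable_EFinP; apply: measurable_funM.
have mE X : measurable X -> (m1 \x m2)%E X = m X.
  move=> mX; apply: (@product_measure_unique _ _ _ _ _ m1 m2 m) => //.
have ik : m.-integrable setT k.
  apply: integrable_pushforward => //.
  exact: (bmeas_integrable (bmeasM bf bg)).
have ik12 : (m1 \x m2)%E.-integrable setT k.
  apply/integrableP; split=> //; have /integrableP[_] := ik.
  by rewrite (@eq_measure_integral _ _ _ _ (m1 \x m2)%E)// => A mA _; exact/esym/mE.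
have i1 : m1.-integrable setT EFin.
  apply: integrable_pushforward => //.
  exact: bmeas_integrable bf.
have i2 : m2.-integrable setT EFin.
  apply: integrable_pushforward => //.
  exact: bmeas_integrable bg.
have EfE : (\int[m1]_x x%:E)%E = (Ex f)%:E.
  rewrite integral_pushforward//; last exact: (bmeas_integrable bf).
  rewrite /Ex /Rintegral fineK//; apply: integrable_fin_num => //.
  exact: (bmeas_integrable bf).
have EgE : (\int[m2]_x x%:E)%E = (Ex g)%:E.
  rewrite integral_pushforward//; last exact: (bmeas_integrable bg).
  rewrite /Ex /Rintegral fineK//; apply: integrable_fin_num => //.
  exact: (bmeas_integrable bg).
apply: EFin_inj; rewrite EFinM -EfE -EgE.
transitivity (\int[m]_z k z)%E.
  rewrite integral_pushforward//; last exact: (bmeas_integrable (bmeasM bf bg)).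
  rewrite /Ex /Rintegral fineK//; apply: integrable_fin_num => //.
  exact: (bmeas_integrable (bmeasM bf bg)).
rewrite -(@eq_measure_integral _ _ _ _ m (m1 \x m2)%E); last first.
  by move=> A mA _; exact: mE.
rewrite -integral12_prod_meas1//.
under eq_integral => x _.
  rewrite /fubini_F /k/=.
  under eq_integral => y _ do rewrite EFinM.
  rewrite integralZl//; over.
by rewrite EgE integralZr.
Qed.

End bounded_expectation.

(** * Gambler's ruin *)

Section stopped_walk.
Context (T : Type) (R : realType).
Variables (xi : nat -> T -> R) (a b : R).

(** Half-open, so that leaving upwards means reaching [b] and leaving downwards means passing
    strictly below [- a]. *)
Definition inside (y : R) : R := if - a <= y < b then 1 else 0.

(* The partial sums of [xi], frozen on leaving [[- a, b[]. *)
Fixpoint stopped n t : R :=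
  if n is m.+1 then stopped m t + inside (stopped m t) * xi m t else 0.

Lemma measurable_inside : measurable_fun setT inside.
Proof.
rewrite (_ : inside = \1_(`[- a, b[%classic)); first exact: measurable_indic.
apply/funext => y; rewrite /inside indicE.
suff -> : (y \in `[- a, b[%classic) = (- a <= y < b) by case: ifP.
by apply/idP/idP; rewrite inE/= in_itv.
Qed.

Lemma inside01 y : 0 <= inside y <= 1.
Proof. by rewrite /inside; case: ifP; rewrite !lexx ler01. Qed.

(** A frozen walk never comes back, so one that is inside has been the plain partial sum all
    along. *)
Lemma stopped_inside n t : - a <= stopped n t < b ->
  stopped n t = \sum_(k < n) xi k t /\
  forall i, (i <= n)%N -> - a <= \sum_(k < i) xi k t.
Proof.
elim: n => [|n IH] /=.
  move=> /andP[a0 _]; split=> [|i]; rewrite ?leqn0 ?big_ord0// => /eqP ->.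
  by rewrite big_ord0.
rewrite /inside; case: ifPn => [ins|out]; last by rewrite mul0r addr0 (negbTE out).
have [sE sge] := IH ins; rewrite mul1r sE => /andP[an _].
split=> [|i]; first by rewrite big_ord_recr.
by rewrite leq_eqVlt => /predU1P[->|]; [rewrite big_ord_recr|exact: sge].
Qed.

(** Turns the event estimated by optional stopping into the pathwise climb that defines a side of a
    valley. *)
Lemma stopped_exit n t : 0 < a -> 0 < b -> b <= stopped n t ->
  exists j, [/\ (j <= n)%N, b <= \sum_(k < j) xi k t &
    forall i, (i <= j)%N -> - a <= \sum_(k < i) xi k t].
Proof.
move=> a0 b0; elim: n => [|n IH] /=; first by move=> /(lt_le_trans b0); rewrite ltxx.
rewrite /inside; case: ifPn => [ins|out]; last first.
  by rewrite mul0r addr0 => /IH[j [jn bj ja]]; exists j; split=> //; exact: leqW.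
have [sE sge] := stopped_inside ins; rewrite mul1r sE => bn.
exists n.+1; split; rewrite ?big_ord_recr//= => i.
rewrite leq_eqVlt => /predU1P[->|]; last exact: sge.
by rewrite big_ord_recr/=; lra.
Qed.

End stopped_walk.

(** Only the first [n] increments have to be measurable, so the sigma-algebra may be the one
    generated by the sites of a block. *)
Lemma measurable_stopped (disp : measure_display) (T : measurableType disp)
    (R : realType) (xi : nat -> T -> R) (a b : R) n :
  (forall k, (k < n)%N -> measurable_fun setT (xi k)) ->
  measurable_fun setT (stopped xi a b n).
Proof.
elim: n => [|n IH] mxi; first exact: measurable_cst.
have mn : measurable_fun setT (stopped xi a b n).
  by apply: IH => k kn; apply: mxi; exact: ltnW.
apply: measurable_funD => //; apply: measurable_funM => //; last exact: mxi.
exact: (measurableT_comp (measurable_inside a b)).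
Qed.

Section gambler.
Context (disp : measure_display) (T : measurableType disp) (R : realType).
Variable P : probability T R.
Variables (xi : nat -> T -> R) (a b C s2 : R).

Local Notation inside := (inside a b).
Local Notation stopped := (stopped xi a b).

Hypotheses (a_gt0 : 0 < a) (ab : a <= b).
Hypothesis mxi : forall n, measurable_fun setT (xi n).
Hypothesis xiC : forall n t, `|xi n t| <= C.

Let b_gt0 : 0 < b. Proof. exact: lt_le_trans ab. Qed.

Let C_ge0 : 0 <= C.
Proof. by apply: le_trans (xiC 0 point). Qed.

Lemma stopped_bound n t : - (a + C) <= stopped n t <= b + C.
Proof.
elim: n => [|n IH] /=.
  by apply/andP; split; have := b_gt0; have := C_ge0; have := a_gt0; lra.
rewrite /inside; case: ifPn => [/andP[h1 h2]|_]; last by rewrite mul0r addr0.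
have := xiC n t; rewrite ler_norml => /andP[x1 x2]; rewrite mul1r.
by apply/andP; split; lra.
Qed.

Lemma stopped_sqr_le n t : stopped n t ^+ 2 <= (b + C) ^+ 2.
Proof.
rewrite -[leLHS]real_normK ?num_real// lerXn2r ?nnegrE ?addr_ge0 ?(ltW b_gt0)//.
have /andP[s1 s2'] := stopped_bound n t.
by rewrite ler_norml; have := ab; have := C_ge0; move=> *; apply/andP; split; lra.
Qed.

Lemma bmeas_stopped n : bmeas (stopped n).
Proof.
split; first exact: measurable_stopped.
exists (b + C) => t; have /andP[s1 s2'] := stopped_bound n t.
by rewrite ler_norml; have := ab; have := C_ge0; move=> *; apply/andP; split; lra.
Qed.

Lemma bmeas_inside n : bmeas (fun t => inside (stopped n t)).
Proof.
split.
  apply: (measurableT_comp (measurable_inside a b)); exact: measurable_stopped.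
exists 1 => t; have /andP[i0 i1] := inside01 a b (stopped n t).
by rewrite ler_norml; have := ab; have := C_ge0; move=> *; apply/andP; split; lra.
Qed.

Lemma bmeas_xi n : bmeas (xi n).
Proof. by split=> //; exists C. Qed.

Hypothesis xi_indep : forall n, indep_pair P (stopped n) (xi n).
Hypothesis xi_mean : forall n, Ex P (xi n) = 0.
Hypothesis xi_var : forall n, Ex P (fun t => xi n t ^+ 2) = s2.

Lemma Ex_stopped n : Ex P (stopped n) = 0.
Proof.
elim: n => [|n IH]; first exact: Ex_cst.
rewrite [LHS](ExD _ (bmeas_stopped n) (bmeasM (bmeas_inside n) (bmeas_xi n))) IH.
rewrite Ex_indepM ?xi_mean ?mulr0 ?addr0//; [exact: bmeas_inside|exact: bmeas_xi|].
apply: (@indep_pair_comp _ _ _ _ (stopped n) (xi n) inside id) => //.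
exact: measurable_inside.
Qed.

(** Wald's second identity: the cross terms vanish by independence and centring, and [inside] is its
    own square. *)
Lemma Ex_stopped_sqr n : Ex P (fun t => stopped n t ^+ 2) =
  s2 * \sum_(k < n) Ex P (fun t => inside (stopped k t)).
Proof.
elim: n => [|n IH].
  by rewrite big_ord0 mulr0 -[RHS](Ex_cst P); congr Ex; apply/funext=> t /=; rewrite expr0n.
have bs := bmeas_stopped n; have bi := bmeas_inside n; have bx := bmeas_xi n.
have bss : bmeas (fun t => stopped n t ^+ 2) by exact: bmeasM.
have bxx : bmeas (fun t => xi n t ^+ 2) by exact: bmeasM.
have bsi := bmeasM bs bi; have bsix := bmeasM bsi bx; have bixx := bmeasM bi bxx.
rewrite (_ : (fun t => _) = (fun t => stopped n t ^+ 2 +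
   (2 * (stopped n t * inside (stopped n t) * xi n t)
   + inside (stopped n t) * xi n t ^+ 2))); last first.
  apply/funext => t /=; rewrite /inside; case: ifP => _; ring.
rewrite ExD//; last by apply: bmeasD => //; apply: bmeasM => //; exact: bmeas_cst.
rewrite ExD//; last by apply: bmeasM => //; exact: bmeas_cst.
rewrite ExZ// IH big_ord_recr/= mulrDr; congr (_ + _).
rewrite Ex_indepM//; last first.
  apply: (@indep_pair_comp _ _ _ _ (stopped n) (xi n) (fun y => y * inside y) id) => //.
  by apply: measurable_funM => //; exact: measurable_inside.
rewrite xi_mean !mulr0 add0r Ex_indepM// ?xi_var 1?mulrC//.
apply: (@indep_pair_comp _ _ _ _ (stopped n) (xi n) inside (fun y => y ^+ 2)) => //.
exact: measurable_inside.
Qed.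

Lemma inside_stopped_anti n t : inside (stopped n.+1 t) <= inside (stopped n t).
Proof.
have [h|h] : inside (stopped n t) = 1 \/ inside (stopped n t) = 0.
  by rewrite /inside; case: ifP => _; [left|right].
- by rewrite h; case/andP: (inside01 a b (stopped n.+1 t)).
- by rewrite /= h mul0r addr0 h.
Qed.

(** The probabilities of being inside decrease in time, so each of the [n] terms in Wald's identity
    is at least the last one, while the second moment stays bounded. *)
Lemma Ex_inside_le n : 0 <= s2 ->
  s2 * (n%:R * Ex P (fun t => inside (stopped n t))) <= (b + C) ^+ 2.
Proof.
move=> s20; apply: (@le_trans _ _ (Ex P (fun t => stopped n t ^+ 2))); last first.
  rewrite -[leRHS](Ex_cst P); apply: Ex_le; last exact: stopped_sqr_le.
    exact: (bmeasM (bmeas_stopped n) (bmeas_stopped n)).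
  exact: bmeas_cst.
rewrite Ex_stopped_sqr ler_wpM2l// mulr_natl -[X in _ *+ X]card_ord -sumr_const.
apply: ler_sum => k _; have := ltn_ord k; elim: n {k} (k : nat) => // n IH k.
rewrite ltnS leq_eqVlt => /predU1P[->|kn].
  by apply: Ex_le => [||t]; [exact: bmeas_inside..|exact: inside_stopped_anti].
apply: le_trans (IH _ kn).
by apply: Ex_le => [||t]; [exact: bmeas_inside..|exact: inside_stopped_anti].
Qed.

(** Optional stopping: the stopped sum plus [a] is at most [a + b + C] above [b], at most [a + b]
    inside, and negative below [- a]; its expectation is [a]. *)
Lemma gambler_ruin n : 0 < s2 ->
  a - (a + b) * ((b + C) ^+ 2 / (s2 * n.+1%:R)) <=
  (a + b + C) * fine (P [set t | b <= stopped n.+1 t]).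
Proof.
move=> s20; set q := Ex P (fun t => inside (stopped n.+1 t)).
have qle : q <= (b + C) ^+ 2 / (s2 * n.+1%:R).
  rewrite ler_pdivlMr ?mulr_gt0// mulrC -mulrA.
  exact: (Ex_inside_le n.+1 (ltW s20)).
set U := [set t | _].
have mU : measurable U.
  rewrite (_ : U = stopped n.+1 @^-1` `[b, +oo[%classic).
    by rewrite -[X in measurable X]setTI; exact: (@measurable_stopped _ _ _ xi a b n.+1).
  by apply/seteqP; split=> t; rewrite /U /preimage /= in_itv/= andbT.
rewrite -Ex_indic//.
have bU := bmeas_indic R mU.
suff : a <= (a + b + C) * Ex P (\1_U) + (a + b) * q.
  move=> h; rewrite lerBlDr (le_trans h)// lerD2l ler_wpM2l//.
  exact: (ltW (addr_gt0 a_gt0 b_gt0)).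
have bi := bmeas_inside n.+1; have bc (r : R) : bmeas (fun=> r : R) := @bmeas_cst _ T R r.
rewrite -!ExZ// -ExD; [|exact: bmeasM..].
apply: (@le_trans _ _ (Ex P (fun t => stopped n.+1 t + a))).
  by rewrite ExD// ?Ex_stopped ?Ex_cst ?add0r//; exact: bmeas_stopped.
apply: Ex_le.
- by apply: bmeasD => //; exact: bmeas_stopped.
- by apply: bmeasD; apply: bmeasM.
move=> t; have tU : (t \in U) = (b <= stopped n.+1 t) by apply/idP/idP; rewrite inE.
have /andP[_] := stopped_bound n.+1 t.
rewrite indicE tU /inside; move: (stopped n.+1 t) => y yb.
have := a_gt0; have := b_gt0; have := C_ge0.
case: (leP b y) => yb' /=; rewrite ?andbF ?andbT ?mulr1 ?mulr0; first by lra.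
by case: (leP (- a) y) => ya; rewrite ?mulr1 ?mulr0; lra.
Qed.

End gambler.

(** * Independence of disjoint sets of sites *)

Section environment_independence.
Context (R : realType).
Variable P : probability (environment R) R.
Implicit Types (I J : set int).

Definition site_events (x : int) : set (set (environment R)) :=
  preimage_set_system setT (fun w : environment R => w x) measurable.

Definition site_cylinders I : set (set (environment R)) :=
  \bigcup_(x in I) site_events x.

Definition sites_sigma I : set (set (environment R)) := <<s site_cylinders I >>.

(** A pi-system generating [sites_sigma I]. *)
Definition rectangles I : set (set (environment R)) :=
  [set A | exists (J : {fset int}) (E : int -> set (environment R)),
    [/\ [set` J] `<=` I, forall x, x \in J -> site_events x (E x) &
        A = \bigcap_(x in [set` J]) E x]].

Lemma site_events_measurable x : site_events x `<=` measurable.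
Proof.
by move=> A xA; apply: sub_sigma_algebra; exists x.
Qed.

Lemma sites_sigma_measurable I : sites_sigma I `<=` measurable.
Proof.
apply: smallest_sub; first exact: sigma_algebra_measurable.
by move=> A [x _]; exact: site_events_measurable.
Qed.

Lemma sites_sigmaS I J : I `<=` J -> sites_sigma I `<=` sites_sigma J.
Proof.
move=> IJ; apply: sub_smallest2r; first exact: smallest_sigma_algebra.
by move=> A [x Ix xA]; exists x => //; exact: IJ.
Qed.

Lemma site_eventsI x : setI_closed (site_events x).
Proof.
move=> A B [A' mA' <-] [B' mB' <-]; exists (A' `&` B'); first exact: measurableI.
by rewrite !setTI preimage_setI.
Qed.

Lemma rectangles_measurable I : rectangles I `<=` measurable.
Proof.
move=> A [J [E [_ EJ ->]]]; apply: fin_bigcap_measurable => // x xJ.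
by apply: (@site_events_measurable x); exact: EJ.
Qed.

Lemma rectanglesT I : rectangles I setT.
Proof.
exists fset0, (fun=> setT); split=> [x|x|]; rewrite /= ?inE//.
by apply/seteqP; split.
Qed.

Lemma rectanglesI I : setI_closed (rectangles I).
Proof.
move=> A B [J1 [E1 [J1I EJ1 ->]]] [J2 [E2 [J2I EJ2 ->]]].
pose E x := (if x \in J1 then E1 x else setT) `&` (if x \in J2 then E2 x else setT).
exists (J1 `|` J2)%fset, E; split.
- by move=> x /=; rewrite inE => /orP[/J1I|/J2I].
- move=> x _; rewrite /E.
  have ST : site_events x setT by exists setT => //; rewrite setTI.
  by apply: site_eventsI; case: ifP => // xJ; [exact: EJ1|exact: EJ2].
- apply/seteqP; split=> w.
    move=> [w1 w2] x _; rewrite /E; split; case: ifPn => // xJ.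
      exact: w1.
    exact: w2.
  move=> wE; split=> x /= xJ.
    by have := wE x; rewrite /= inE xJ /E xJ => /(_ isT)[].
  by have := wE x; rewrite /= inE xJ orbT /E xJ => /(_ isT)[].
Qed.

Lemma cylinders_rectangles I : site_cylinders I `<=` rectangles I.
Proof.
move=> A [x Ix xA]; exists [fset x]%fset, (fun=> A); split.
- by move=> y /=; rewrite inE => /eqP ->.
- by move=> y; rewrite inE => /eqP ->.
- by apply/seteqP; split=> w; [move=> wA y|move=> /(_ x)/=; rewrite inE eqxx; exact].
Qed.

Lemma sites_sigma_rectangles I : sites_sigma I `<=` <<s rectangles I >>.
Proof.
apply: sub_smallest2r; first exact: smallest_sigma_algebra.
exact: cylinders_rectangles.
Qed.

Hypothesis P_indep : mutually_independent P site_events.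

Lemma rectangles_indep I J A B : I `&` J = set0 -> rectangles I A ->
  rectangles J B -> P (A `&` B) = (P A * P B)%E.
Proof.
move=> IJ0 [J1 [E1 [J1I EJ1 ->]]] [J2 [E2 [J2I EJ2 ->]]].
have disj x : x \in J1 -> x \in J2 -> False.
  move=> x1 x2; have : (I `&` J) x by split; [exact: J1I|exact: J2I].
  by rewrite IJ0.
pose E x := if x \in J1 then E1 x else E2 x.
have -> : (\bigcap_(x in [set` J1]) E1 x) `&` (\bigcap_(x in [set` J2]) E2 x) =
    \bigcap_(x in [set` (J1 `|` J2)%fset]) E x.
  apply/seteqP; split=> w.
    move=> [w1 w2] x /=; rewrite inE /E => /orP[xJ|xJ].
      by rewrite xJ; exact: w1.
    by case: ifPn => [/disj/(_ xJ)//|_]; exact: w2.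
  move=> wE; split=> x /= xJ.
    by have := wE x; rewrite /= inE xJ /E xJ; exact.
  have := wE x; rewrite /= inE xJ orbT /E; case: ifPn => [/disj/(_ xJ)//|_].
  exact.
rewrite P_indep; last first.
  move=> x; rewrite inE /E => /orP[xJ|xJ]; first by rewrite xJ; exact: EJ1.
  by case: ifPn => [/disj/(_ xJ)//|_]; exact: EJ2.
rewrite (perm_big (J1 ++ J2)); last first.
  apply: uniq_perm; rewrite ?fset_uniq ?cat_uniq ?fset_uniq ?andbT//=.
    by apply/hasPn => x x2; apply/negP => x1; exact: (disj x).
  by move=> x; rewrite inE mem_cat.
rewrite big_cat/= !P_indep//; congr (_ * _)%E; apply: eq_big_seq => x xJ; rewrite /E.
  by rewrite xJ.
by case: ifPn => [/disj/(_ xJ)|].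
Qed.

(** Uniqueness of finite measures that agree on a pi-system, for the restriction of [P] to [B] and
    the multiple of [P] by the probability of [B]. *)
Lemma dynkin_indep (G : set (set (environment R))) B :
  G `<=` measurable -> setI_closed G -> G setT -> measurable B ->
  (forall A, G A -> P (A `&` B) = (P A * P B)%E) ->
  forall A, <<s G >> A -> P (A `&` B) = (P A * P B)%E.
Proof.
move=> Gm GI GT mB GE A sA.
have PB0 : 0 <= fine (P B) by exact: fine_ge0.
have PBE : (fine (P B))%:E = P B by rewrite fineK// fin_num_measure.
have mE C : mscale (NngNum PB0) P C = (P C * P B)%E by rewrite /mscale/= PBE muleC.
rewrite -mE; suff : mrestr P mB A = mscale (NngNum PB0) P A.
  by [].
apply: (@g_sigma_algebra_measure_unique _ R _ G Gm (fun=> setT)) => //.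
- by rewrite bigcup_const//; exists 0%N.
- by move=> C GC; transitivity (P C * P B)%E; [exact: GE|exact/esym/mE].
- move=> _; apply: (@le_lt_trans _ _ (P (setT `&` B))) => //.
  by rewrite setTI (le_lt_trans (probability_le1 _ mB))// ltry.
Qed.

(** Passes from rectangles to the generated sigma-algebras one argument at a time. *)
Lemma sites_sigma_indep I J A B : I `&` J = set0 ->
  sites_sigma I A -> sites_sigma J B -> P (A `&` B) = (P A * P B)%E.
Proof.
move=> IJ0 sA sB.
apply: (dynkin_indep (@rectangles_measurable I) (@rectanglesI I) (rectanglesT I));
  [exact: sites_sigma_measurable sB| |exact: sites_sigma_rectangles].
move=> A' rA'; rewrite setIC muleC.
apply: (dynkin_indep (@rectangles_measurable J) (@rectanglesI J) (rectanglesT J));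
  [exact: rectangles_measurable rA'| |exact: sites_sigma_rectangles].
by move=> B' rB'; rewrite setIC muleC; exact: (rectangles_indep IJ0 rA' rB').
Qed.

(** Peels off one event at a time: the remaining ones depend on the union of their blocks, which is
    disjoint from the block of the first. *)
Lemma sites_sigma_mutual_indep (I : nat -> set int) (A : nat -> set (environment R)) s :
  (forall k l, k <> l -> I k `&` I l = set0) ->
  (forall k, sites_sigma (I k) (A k)) -> uniq s ->
  P [set w | forall k, k \in s -> A k w] = (\prod_(k <- s) P (A k))%E.
Proof.
move=> Idisj sA; elim: s => [|k s IH] /=.
  rewrite big_nil (_ : [set w | _] = setT) ?probability_setT//.
  by apply/seteqP; split.
move=> /andP[ks us]; rewrite big_cons -IH//.
have -> : [set w | forall l, l \in k :: s -> A l w] =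
    A k `&` [set w | forall l, l \in s -> A l w].
  apply/seteqP; split=> w.
    by move=> wA; split=> [|l ls]; apply: wA; rewrite inE ?eqxx// ls orbT.
  by move=> [wk ws] l; rewrite inE => /predU1P[->//|]; exact: ws.
apply: (@sites_sigma_indep (I k) (\bigcup_(l in [set` s]) I l)) => //.
  apply/seteqP; split=> // x [xk [l ls xl]].
  have kl : k <> l by move=> kl; move: ks; rewrite kl ls.
  by have : (I k `&` I l) x by []; rewrite Idisj.
pose T' := g_sigma_algebraType (site_cylinders (\bigcup_(l in [set` s]) I l)).
rewrite (_ : [set w | _] = \bigcap_(l in [set` s]) A l); last by apply/seteqP; split.
apply: (@bigcap_measurableType _ T') => // l ls.
by apply: sites_sigmaS (sA l); exact: bigcup_sup.
Qed.

End environment_independence.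

(** * Potential of a random environment *)

Section truncated_log_rho.
Context (R : realType).
Variable eps : R.
Hypotheses (eps_gt0 : 0 < eps) (eps_lt1 : eps < 1).

Definition logit (y : R) : R := ln (1 - y) - ln y.

(* Equal to the log-ratio [ln rho] on elliptic environments, but bounded
   everywhere. *)
Definition tlog (y : R) : R := \1_(`[eps, 1 - eps]%classic) y * logit y.

Lemma measurable_logit : measurable_fun setT logit.
Proof.
apply: measurable_funB; last exact: measurable_ln.
apply: (measurableT_comp (@measurable_ln R)).
by apply: measurable_funB.
Qed.

Lemma measurable_tlog : measurable_fun setT tlog.
Proof. by apply: measurable_funM; [exact: measurable_indic|exact: measurable_logit]. Qed.

Lemma logitE y : 0 < y < 1 -> logit y = ln ((1 - y) / y).
Proof. by move=> /andP[y0 y1]; rewrite ln_div ?posrE// subr_gt0. Qed.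

(** Outside []0, 1[] the ratio is nonpositive, where [ln] takes the value 0. This form makes the
    log-ratio measurable everywhere. *)
Lemma ln_rhoE y : ln ((1 - y) / y) = \1_(`]0, 1[%classic) y * logit y.
Proof.
rewrite indicE; case: (boolP (0 < y < 1)) => y01.
  by rewrite mem_set ?mul1r ?logitE//= in_itv.
rewrite memNset ?mul0r; last by rewrite /= in_itv/=; exact/negP.
apply: ln0; move: y01; rewrite negb_and -!leNgt => /orP[y0|y1].
  by rewrite mulr_ge0_le0 ?invr_le0//; lra.
by rewrite mulr_le0_ge0 ?invr_ge0//; lra.
Qed.

Lemma tlogE y : eps <= y <= 1 - eps -> tlog y = ln ((1 - y) / y).
Proof.
move=> ye; rewrite /tlog indicE mem_set ?mul1r ?logitE//= ?in_itv//=.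
by move: ye => /andP[? ?]; apply/andP; split; have := eps_gt0; lra.
Qed.

Lemma tlog_bound y : `|tlog y| <= - ln eps.
Proof.
have e0 := eps_gt0; have e1 := eps_lt1.
case: (boolP (eps <= y <= 1 - eps)) => [ye|yN]; last first.
  rewrite /tlog indicE memNset ?mul0r ?normr0; last by rewrite /= in_itv/=; exact/negP.
  by rewrite oppr_ge0 ln_le0// ltW.
rewrite tlogE//; move: ye => /andP[ye1 ye2]; have y0 : 0 < y by lra.
have q0 : 0 < (1 - y) / y by rewrite divr_gt0//; lra.
rewrite ler_norml opprK ler_ln ?posrE// -lnV ?posrE//.
rewrite ler_ln ?posrE ?invr_gt0// ler_pdivlMr// ler_pdivrMr//; apply/andP; split.
  by rewrite (@le_trans _ _ eps)//; [rewrite ler_piMr//; lra|lra].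
rewrite (@le_trans _ _ 1)//; first lra.
by rewrite -ler_pdivrMl ?invr_gt0// invrK mulr1.
Qed.

End truncated_log_rho.

(** Every integer is a difference of two naturals, which turns intersections over the integers into
    intersections over [nat]. *)
Lemma int_natB (x : int) : `|x|%N%:Z - `|(`|x|%N%:Z - x)%R|%N%:Z = x.
Proof. lia. Qed.

Lemma probability1_bigcap (disp : measure_display) (T : measurableType disp)
    (R : realType) (P : probability T R) (F : (set T)^nat) :
  (forall n, measurable (F n)) -> (forall n, P (F n) = 1%E) ->
  P (\bigcap_n F n) = 1%E.
Proof.
move=> mF F1; have mI : measurable (\bigcap_n F n) by exact: bigcapT_measurable.
have : P (~` \bigcap_n F n) = 0%E.
  apply: measure_negligible; first exact: measurableC.
  rewrite setC_bigcap; apply: negligible_bigcup => n.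
  have F0 : P (~` F n) = 0%E by rewrite probability_setC// F1 subee.
  by apply/negligibleP => //; exact: measurableC.
rewrite probability_setC// => /eqP; rewrite sube_eq ?fin_num_measure//.
by rewrite add0e eq_sym => /eqP.
Qed.

(** * Moments and ellipticity of the i.i.d. environment *)

Section environment_law.
Context (R : realType).
Variable P : probability (environment R) R.
Hypothesis P_iid : iid_environment_law P.
Variable eps : R.
Hypotheses (eps_gt0 : 0 < eps) (eps_lt1 : eps < 1).
Hypothesis elliptic : P [set w : environment R | eps <= w 0 <= 1 - eps] = 1%E.
Hypothesis E_log_rho : ('E_P[fun w => ln (rho w 0)] = 0)%E.
Hypothesis V_log_rho : (0 < 'V_P[fun w => ln (rho w 0)])%E.

Local Notation tlog := (tlog eps).

Lemma measurable_site x : measurable_fun setT (fun w : environment R => w x).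
Proof.
move=> _ B mB; apply: sub_sigma_algebra; exists x => //; by exists B.
Qed.

Lemma Ex_site x (f : R -> R) : measurable_fun setT f -> (exists M, forall y, `|f y| <= M) ->
  Ex P (fun w => f (w x)) = Ex P (fun w => f (w 0)).
Proof.
move=> mf fM.
have bm y : bmeas (fun w : environment R => f (w y)).
  split; first exact: (measurableT_comp mf (measurable_site y)).
  by case: fM => M fM; exists M.
rewrite /Ex /Rintegral; congr fine.
pose g y : \bar R := (f y)%:E.
have mg : measurable_fun setT g by exact/measurable_EFinP.
pose S y : {mfun environment R >-> R} := HB.pack (fun w : environment R => w y)
  (isMeasurableFun.Build _ _ _ _ _ (measurable_site y)).
have E y : (\int[P]_w (f (w y))%:E = \int[distribution P (S y)]_z g z)%E.
  rewrite integral_pushforward//.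
  exact: (bmeas_integrable P (bm y)).
rewrite !E; apply: eq_measure_integral => A mA _.
have [_ _ idl] := P_iid; exact: idl.
Qed.

Lemma elliptic_set_measurable x :
  measurable [set w : environment R | eps <= w x <= 1 - eps].
Proof.
rewrite (_ : [set w | _] = (fun w : environment R => w x) @^-1` `[eps, 1 - eps]%classic).
  by rewrite -[X in measurable X]setTI; exact: measurable_site.
by apply/seteqP; split=> w; rewrite /preimage/= in_itv.
Qed.

Lemma elliptic_site x : P [set w : environment R | eps <= w x <= 1 - eps] = 1%E.
Proof.
have [_ _ /(_ x `[eps, 1 - eps]%classic)] := P_iid.
have E y : [set w : environment R | `[eps, 1 - eps]%classic (w y)] =
    [set w : environment R | eps <= w y <= 1 - eps].
  by apply/seteqP; split=> w; rewrite /= in_itv.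
by rewrite !E elliptic; apply.
Qed.

Lemma elliptic_sitesE : [set w : environment R | forall x, eps <= w x <= 1 - eps] =
  \bigcap_n \bigcap_(m in [set: nat]) [set w | eps <= w (n%:Z - m%:Z) <= 1 - eps].
Proof.
apply/seteqP; split=> [w wx n _ m _|w wx x]; first exact: wx.
by have := wx `|x|%N I `|(`|x|%N%:Z - x)%R|%N I; rewrite /= int_natB.
Qed.

Lemma elliptic_sites_measurable :
  measurable [set w : environment R | forall x, eps <= w x <= 1 - eps].
Proof.
rewrite elliptic_sitesE; apply: bigcapT_measurable => n.
by apply: bigcapT_measurable => m; exact: elliptic_set_measurable.
Qed.

Lemma elliptic_sites : P [set w : environment R | forall x, eps <= w x <= 1 - eps] = 1%E.
Proof.
rewrite elliptic_sitesE; apply: probability1_bigcap => n.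
  by apply: bigcapT_measurable => m; exact: elliptic_set_measurable.
by apply: probability1_bigcap => m; [exact: elliptic_set_measurable|exact: elliptic_site].
Qed.

(** Transfers the moment hypotheses on [ln (rho w 0)] to the bounded variable [tlog (w 0)], almost
    surely equal to it by ellipticity. *)
Lemma tlog_ae (F : R -> R) : measurable_fun setT F ->
  (\int[P]_w (F (ln (rho w 0)))%:E = \int[P]_w (F (tlog (w 0)))%:E)%E.
Proof.
move=> mF; apply: ae_eq_integral => //.
- apply/measurable_EFinP; apply: (measurableT_comp mF).
  rewrite (_ : (fun w => _) =
      (fun w : environment R => \1_(`]0, 1[%classic) (w 0) * logit (w 0))).
    have m1 : measurable_fun setT (fun y : R => \1_(`]0, 1[%classic) y * logit y).
      by apply: measurable_funM; [exact: measurable_indic|exact: measurable_logit].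
    exact: (measurableT_comp m1 (measurable_site 0)).
  by apply/funext => w; rewrite /rho ln_rhoE.
- apply/measurable_EFinP; apply: (measurableT_comp mF).
  exact: (measurableT_comp (measurable_tlog eps) (measurable_site 0)).
- have E0 : P (~` [set w : environment R | eps <= w 0 <= 1 - eps]) = 0%E.
    by rewrite probability_setC ?elliptic ?subee//; exact: elliptic_set_measurable.
  exists (~` [set w : environment R | eps <= w 0 <= 1 - eps]); split => //.
  + by apply: measurableC; exact: elliptic_set_measurable.
  + by move=> w; apply: contra_not => we _; rewrite tlogE.
Qed.

Lemma bounded_tlog : exists M, forall y, `|tlog y| <= M.
Proof. by exists (- ln eps); exact: tlog_bound. Qed.

Lemma Ex_tlog x : Ex P (fun w => tlog (w x)) = 0.
Proof.
rewrite (Ex_site x (measurable_tlog eps) bounded_tlog).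
have := tlog_ae (@measurable_id _ R setT).
move: E_log_rho; rewrite unlock => -> E0.
by rewrite /Ex /Rintegral -[X in fine X]E0.
Qed.

Lemma Ex_tlog_sqr x : Ex P (fun w => tlog (w x) ^+ 2) = Ex P (fun w => tlog (w 0) ^+ 2).
Proof.
apply: (Ex_site x (f := fun y => tlog y ^+ 2)).
  by apply: measurable_funM; exact: measurable_tlog.
exists ((- ln eps) ^+ 2) => y; rewrite normrX lerXn2r ?nnegrE//; last exact: tlog_bound.
by rewrite (le_trans (normr_ge0 _) (tlog_bound eps_gt0 eps_lt1 y)).
Qed.

Lemma Ex_tlog_sqr_gt0 : 0 < Ex P (fun w => tlog (w 0) ^+ 2).
Proof.
have VE : ('V_P[fun w => ln (rho w 0)] = \int[P]_w (tlog (w 0) ^+ 2)%:E)%E.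
  rewrite -(tlog_ae (F := fun y => y ^+ 2)); last exact: measurable_funM.
  rewrite /variance covariance.unlock E_log_rho expectation.unlock.
  by apply: eq_integral => w _; rewrite /= mulrfctE /= subr0 expr2.
have b1 : bmeas (fun w : environment R => tlog (w 0)).
  split; last by exists (- ln eps) => w; exact: tlog_bound.
  exact: (measurableT_comp (measurable_tlog eps) (measurable_site 0)).
have fin := integrable_fin_num measurableT (bmeas_integrable P (bmeasM b1 b1)).
by move: V_log_rho; rewrite VE -lte_fin /Ex /Rintegral fineK.
Qed.

(** * Climbs of the potential over a block of sites *)

Section block.
Variables (e : nat -> int) (sgn : R).
Hypotheses (e_inj : injective e) (sgn_sqr : sgn ^+ 2 = 1).

(** Increment of the potential when moving away from the origin: [e] lists the sites of one side
    outwards, and [sgn] is 1 on the right and -1 on the left. *)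
Definition block_step k (w : environment R) : R := sgn * tlog (w (e k)).

Definition block_event (a b : R) n : set (environment R) :=
  [set w | b <= stopped block_step a b n w].

Definition block_sites n : set int := [set e k | k in `I_n].

Lemma measurable_block_step_sub I k : I (e k) ->
  measurable_fun (setT : set (g_sigma_algebraType (@site_cylinders R I))) (block_step k).
Proof.
move=> Ik; apply: measurable_funM => //.
have mk : measurable_fun (setT : set (g_sigma_algebraType (@site_cylinders R I)))
    (fun w => w (e k)).
  move=> _ B mB; apply: sub_sigma_algebra; exists (e k) => //; by exists B.
exact: (measurableT_comp (measurable_tlog eps) mk).
Qed.

Lemma sub_preimage_sigma I (f : environment R -> R) A :
  measurable_fun (setT : set (g_sigma_algebraType (@site_cylinders R I))) f ->
  measurable A -> sites_sigma I (f @^-1` A).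
Proof. by move=> mf mA; have := mf measurableT A mA; rewrite setTI. Qed.

Lemma measurable_stopped_sub a b n :
  measurable_fun (setT : set (g_sigma_algebraType (@site_cylinders R (block_sites n))))
    (stopped block_step a b n).
Proof.
apply: (@measurable_stopped _ (g_sigma_algebraType (@site_cylinders R (block_sites n)))).
by move=> k kn; apply: measurable_block_step_sub; exists k.
Qed.

Lemma block_event_sigma a b n : sites_sigma (block_sites n) (block_event a b n).
Proof.
rewrite (_ : block_event a b n = stopped block_step a b n @^-1` `[b, +oo[%classic).
  by apply: sub_preimage_sigma => //; exact: measurable_stopped_sub.
by apply/seteqP; split=> w; rewrite /block_event /preimage /= in_itv/= andbT.
Qed.

(** Gambler's ruin with increments bounded by [- ln eps]. As [e] is injective, the next increment
    uses a site that the stopped sum has not seen. *)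
Lemma block_event_prob a b n : 0 < a -> a <= b ->
  a - (a + b) * ((b - ln eps) ^+ 2 / (Ex P (fun w => tlog (w 0) ^+ 2) * n.+1%:R)) <=
  (a + b - ln eps) * fine (P (block_event a b n.+1)).
Proof.
move=> a0 ab; have nsgn : `|sgn| = 1.
  by apply/eqP; rewrite -sqrp_eq1// real_normK ?num_real// sgn_sqr.
have mtl y : measurable_fun setT (fun w : environment R => tlog (w y)).
  exact: (measurableT_comp (measurable_tlog eps) (measurable_site y)).
have bt y : bmeas (fun w : environment R => tlog (w y)).
  by split=> //; exists (- ln eps) => w; exact: tlog_bound.
apply: gambler_ruin => //.
- by move=> k; apply: measurable_funM.
- by move=> k w; rewrite normrM nsgn mul1r tlog_bound.
- move=> k A B mA mB; have [_ indep _] := P_iid.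
  apply: (@sites_sigma_indep _ P indep (block_sites k) [set e k]) => //.
  + apply/seteqP; split=> // x [[j jk <-]] /= /e_inj jE.
    by move: jk; rewrite /= jE ltnn.
  + by apply: sub_preimage_sigma => //; exact: measurable_stopped_sub.
  + by apply: sub_preimage_sigma => //; exact: measurable_block_step_sub.
- by move=> k; rewrite ExZ// Ex_tlog mulr0.
- move=> k; rewrite -(Ex_tlog_sqr (e k)); congr Ex; apply/funext => w.
  by rewrite exprMn sgn_sqr mul1r.
- exact: Ex_tlog_sqr_gt0.
Qed.

End block.

End environment_law.

(** * Return probability in a valley *)

(** The first [r] increments, which belong to smaller scales, move the sums by at most [C * r]; both
    levels worsen by that amount. *)
Lemma walk_after_delay (R : realType) (f : nat -> R) (r n : nat) (a b C : R) :
  0 <= a -> (forall k, `|f k| <= C) ->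
  (exists j, [/\ (j <= n)%N, b <= \sum_(k < j) f (r + k)%N &
    forall i, (i <= j)%N -> - a <= \sum_(k < i) f (r + k)%N]) ->
  exists m, [/\ (m <= r + n)%N, b - C * r%:R <= \sum_(k < m) f k &
    forall i, (i <= m)%N -> - (C * r%:R + a) <= \sum_(k < i) f k].
Proof.
move=> a0 fC [j [jn bj ja]]; exists (r + j)%N.
have C0 : 0 <= C by exact: le_trans (fC 0%N).
have low i : (i <= r)%N -> - (C * r%:R) <= \sum_(k < i) f k.
  move=> ir; apply: (@le_trans _ _ (- (C * i%:R))).
    by rewrite lerN2 ler_wpM2l// ler_nat.
  rewrite -mulNr mulr_natr -[X in _ *+ X]card_ord -sumr_const.
  by apply: ler_sum => k _; have := fC k; rewrite ler_norml => /andP[].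
have split i : \sum_(k < r + i) f k = \sum_(k < r) f k + \sum_(k < i) f (r + k)%N.
  by rewrite big_split_ord.
have lowr := low r (leqnn _).
split; first by rewrite leq_add2l.
  by rewrite split; lra.
move=> i; case: (leqP i r) => [/low h _|ri ij]; first by lra.
have [l E] : exists l, i = (r + l)%N by exists (i - r)%N; rewrite subnKC// ltnW.
by have := ja l; rewrite E split -(leq_add2l r) -E => /(_ ij); lra.
Qed.

Section valley.
Context (R : realType).
Variables (w : int -> R) (C : R).
Hypothesis w01 : forall x, 0 < w x < 1.

Definition log_ratio x : R := ln ((1 - w x) / w x).

Hypothesis log_ratio_bound : forall x, `|log_ratio x| <= C.

Let right_step k : R := log_ratio k.+1%:Z.
Let left_step k : R := - log_ratio (- k%:Z).

(** This is [exp (- V x)], for the potential [V] that vanishes at 0 and has increment [log_ratio x]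
    from [x - 1] to [x]. *)
Definition potential_conductance (x : int) : R := match x with
  | Posz n => expR (- \sum_(k < n) right_step k)
  | Negz n => expR (- \sum_(k < n.+1) left_step k) end.

Local Notation c := potential_conductance.

Lemma potential_conductanceN n : c (- n%:Z) = expR (- \sum_(k < n) left_step k).
Proof.
case: n => [|n]; last by rewrite -NegzE.
by rewrite (_ : - 0%:Z = 0%:Z) //= !big_ord0.
Qed.

Lemma potential_conductance_gt0 x : 0 < c x.
Proof. by case: x => n; exact: expR_gt0. Qed.

Lemma ratio_gt0 x : 0 < (1 - w x) / w x.
Proof. by have /andP[w0 w1] := w01 x; rewrite divr_gt0// subr_gt0. Qed.

Lemma potential_conductance_pred x : c (x - 1) = (1 - w x) / w x * c x.
Proof.
have rE : (1 - w x) / w x = expR (log_ratio x) by rewrite lnK// posrE ratio_gt0.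
rewrite rE; case: x {rE} => [[|n]|n].
- rewrite -[_ - 1]/(- 1%:Z) potential_conductanceN big_ord1 /= big_ord0 oppr0.
  by rewrite expR0 mulr1 /left_step opprK.
- rewrite (_ : n.+1%:Z - 1 = n%:Z) /=; last by lia.
  by rewrite -expRD big_ord_recr/= /right_step; congr expR; lra.
- rewrite NegzE (_ : - n.+1%:Z - 1 = - n.+2%:Z); last by lia.
  rewrite !potential_conductanceN -expRD [in LHS]big_ord_recr/= /left_step.
  by congr expR; lra.
Qed.

Lemma potential_conductanceE x : w x * edge_measure c x = c x.
Proof.
have /andP[w0 w1] := w01 x.
rewrite /edge_measure potential_conductance_pred; field.
by rewrite gt_eqF.
Qed.

(** The valley is cut where the potential has climbed: there the conductances are at most [1 / Y],
    so exit before time [N] is unlikely. In between they are at most [X], which bounds the total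
    mass by [4 * (r + n) * X]. *)
Lemma valley_return_prob (r n N : nat) (a b : R) :
  0 <= a -> C * r%:R < b ->
  (exists j, [/\ (j <= n)%N, b <= \sum_(k < j) log_ratio (r + k).+1%:Z &
    forall i, (i <= j)%N -> - a <= \sum_(k < i) log_ratio (r + k).+1%:Z]) ->
  (exists j, [/\ (j <= n)%N, b <= \sum_(k < j) - log_ratio (- (r + k)%N%:Z) &
    forall i, (i <= j)%N -> - a <= \sum_(k < i) - log_ratio (- (r + k)%N%:Z)]) ->
  4 * N%:R <= expR (b - C * r%:R) ->
  (16 * (r + n)%:R * expR (C * r%:R + a))^-1 <= return_prob w N.*2.
Proof.
move=> a0 Crb Hr Hl HN.
have [M [Mn bM aM]] := @walk_after_delay R right_step r n a b C a0
  (fun k => log_ratio_bound _) Hr.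
have lC k : `|left_step k| <= C by rewrite normrN.
have [m [mn bm am]] := @walk_after_delay R left_step r n a b C a0 lC Hl.
(* The left climb ends at a nonzero site because [b - C * r > 0]. Written [- m - 1], it indexes the
   edge by which the walk leaves [[- m, M]]; on the right that edge is indexed by [M]. *)
case: m mn bm am => [|m] mn bm am; first by move: bm; rewrite big_ord0; lra.
set X := expR (C * r%:R + a); set Y := expR (b - C * r%:R) in HN.
have X0 : 0 < X := expR_gt0 _; have Y0 : 0 < Y := expR_gt0 _.
have cM : c M%:Z <= Y^-1 by rewrite /= -expRN ler_expR; lra.
have cm : c (- m%:Z - 1) <= Y^-1.
  rewrite (_ : - m%:Z - 1 = - m.+1%:Z); last by lia.
  by rewrite potential_conductanceN -expRN ler_expR; lra.
have cX x : - m%:Z - 1 <= x <= M%:Z -> c x <= X.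
  case: x => i iI /=; rewrite ler_expR.
    have iM : (i <= M)%N by clear -iI; lia.
    by have := aM i iM; lra.
  have im : (i.+1 <= m.+1)%N by clear -iI; lia.
  by have := am i.+1 im; lra.
have c0 : c 0 = 1 by rewrite -[LHS]/(expR _) big_ord0 oppr0 expR0.
have q0 : 1 <= edge_measure c 0.
  by rewrite /edge_measure c0 lerDl ltW// potential_conductance_gt0.
apply: le_trans (return_prob_ge potential_conductance_gt0 potential_conductanceE
  (m := m) (M := M) (n := N) _); last first.
  apply: (@le_trans _ _ 2^-1); last by lra.
  apply: (@le_trans _ _ (N%:R * (Y^-1 + Y^-1))); first by rewrite ler_wpM2l// lerD.
  have := ler_pM2r (x := Y^-1); rewrite invr_gt0 => /(_ Y0 (4 * N%:R) Y).
  rewrite HN divff ?gt_eqF// => h; lra.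
set S := isum _ _ _.
have S0 : 0 < S.
  rewrite /S /isum big_ord_recl ltr_pwDl ?edge_measure_gt0//.
    exact: potential_conductance_gt0.
  apply: sumr_ge0 => i _; apply: ltW; apply: edge_measure_gt0.
  exact: potential_conductance_gt0.
have SX : S <= 4 * (r + n)%:R * X.
  apply: (@le_trans _ _ (\sum_(i < (m + M).+1) (2 * X))).
    apply: ler_sum => i _; rewrite /edge_measure mulr_natl mulr2n.
    by case: i => i iK /=; apply: lerD; apply: cX; clear -iK; lia.
  rewrite sumr_const card_ord -[leLHS]mulr_natr mulrAC ler_pM2r//.
  have : (m + M).+1%:R <= (2 * (r + n))%:R :> R by rewrite ler_nat; clear -mn Mn; lia.
  by rewrite natrM; lra.
apply: (@le_trans _ _ (1 / (4 * S))); last by rewrite ler_pM2r ?invr_gt0 ?mulr_gt0.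
rewrite div1r lef_pV2 ?posrE ?mulr_gt0//; first lra.
by rewrite ltr0n (leq_trans _ mn).
Qed.

End valley.

(** * Second Borel-Cantelli lemma *)

Section second_borel_cantelli.
Context (disp : measure_display) (T : measurableType disp) (R : realType).
Variables (P : probability T R) (E : nat -> set T) (e : nat -> R) (p : R).
Hypothesis mE : forall k, measurable (E k).
Hypothesis E_indep : forall s, uniq s ->
  pr P [set t | forall k, k \in s -> E k t] = \prod_(k <- s) e k.

Definition sieve (s s' : seq nat) : set T :=
  [set t | (forall k, k \in s -> E k t) /\ (forall k, k \in s' -> ~ E k t)].

Lemma measurable_sieve s s' : measurable (sieve s s').
Proof.
rewrite (_ : sieve s s' = (\bigcap_(k in [set` s]) E k) `&`
    (\bigcap_(k in [set` s']) ~` E k)); last by apply/seteqP; split.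
apply: measurableI; apply: bigcap_measurableType => // k _; exact: measurableC.
Qed.

(** Independence passes to complements: each new [E k] splits the sieve in two. *)
Lemma pr_sieve s s' : uniq (s ++ s') ->
  pr P (sieve s s') = \prod_(k <- s) e k * \prod_(k <- s') (1 - e k).
Proof.
elim: s' s => [|k s' IH] s.
  rewrite cats0 big_nil mulr1 => us; rewrite -E_indep//; congr pr.
  by apply/seteqP; split=> t; [case|split].
move=> us; have us1 : uniq ((k :: s) ++ s').
  by move: us; rewrite -cat1s uniq_catCA.
have us2 : uniq (s ++ s') by case/andP: us1.
have := pr_setID P (measurable_sieve s s') (mE k).
rewrite (_ : sieve s s' `&` E k = sieve (k :: s) s'); last first.
  apply/seteqP; split=> t.
    by move=> [[ts ts'] tk]; split=> // l; rewrite inE => /predU1P[->//|]; exact: ts.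
  move=> [ts ts']; split; last by apply: ts; rewrite inE eqxx.
  by split=> // l ls; apply: ts; rewrite inE ls orbT.
rewrite (_ : sieve s s' `\` E k = sieve s (k :: s')); last first.
  apply/seteqP; split=> t.
    by move=> [[ts ts'] tk]; split=> // l; rewrite inE => /predU1P[->//|]; exact: ts'.
  move=> [ts ts']; split; last by apply: ts'; rewrite inE eqxx.
  by split=> // l ls; apply: ts'; rewrite inE ls orbT.
rewrite !IH// !big_cons => /eqP; rewrite addrC -subr_eq => /eqP <-; ring.
Qed.

Hypotheses (p_gt0 : 0 < p) (pe : forall k, p <= e k).

(** For every [n], no [E k] occurs from [m] on with probability at most [(1 - p) ^+ n]. *)
Lemma second_borel_cantelli :
  P.-negligible [set t | ~ forall m, exists2 k, (m <= k)%N & E k t].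
Proof.
have e1 k : e k <= 1.
  have := @E_indep [:: k] isT; rewrite big_seq1 => <-; apply: pr_le1.
  rewrite (_ : [set t | _] = E k)//; apply/seteqP; split=> t.
    by apply; rewrite inE.
  by move=> tk l; rewrite inE => /eqP ->.
pose F m := \bigcap_(k in [set k | (m <= k)%N]) ~` E k.
have mF m : measurable (F m).
  by apply: bigcap_measurableType => // k _; exact: measurableC.
have F0 m : P (F m) = 0%E.
  rewrite prE//; congr (_%:E); apply/eqP; rewrite eq_le pr_ge0 andbT.
  apply/ler_addgt0Pl => eps e0; rewrite addr0.
  have p1 : `|1 - p| < 1.
    rewrite ltr_norml; apply/andP.
    by have := pe 0; have := e1 0%N; have := p_gt0; split; lra.
  have /cvgrPdist_le/(_ eps e0)[n _ /(_ n (leqnn n))] := cvg_expr p1.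
  rewrite sub0r normrN => npow; apply: le_trans (le_trans (ler_norm _) npow).
  apply: (@le_trans _ _ (pr P (sieve [::] (iota m n)))).
    apply: pr_le => //; first exact: measurable_sieve.
    by move=> t Ft; split=> // k; rewrite mem_iota => /andP[mk _]; exact: Ft.
  rewrite pr_sieve ?cat0s ?iota_uniq// big_nil mul1r.
  rewrite -[X in _ <= _ ^+ X](size_iota m n).
  elim: (iota m n) => [|k s IH]; rewrite ?big_nil// big_cons exprS.
  rewrite ler_pM ?subr_ge0// ?lerD2l ?lerN2//.
  by apply: prodr_ge0 => l _; rewrite subr_ge0.
apply: (@negligibleS _ _ _ _ (\bigcup_m F m)).
  move=> t /= /existsNP[m tm]; exists m => // k /= mk tk; apply: tm.
  by exists k.
by apply: negligible_bigcup => m; apply/negligibleP; [exact: mF|exact: F0].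
Qed.

End second_borel_cantelli.

(** * Choice of the scale of a valley *)

(** [r] counts the sites already used on each side and [k] is the target for the sum of return
    probabilities. The block length is of diffusive order [L ^+ 2], which makes the error term of
    [gambler_ruin] small; the rest holds for large [L]. *)
Lemma exists_scale (R : realType) (C s2 delta : R) (r k : nat) :
  0 <= C -> 0 < s2 -> 0 < delta ->
  exists Ln : R * nat, let L := Ln.1 in let n := Ln.2 in
  [/\ 1 <= L, C * r%:R <= delta * L,
      16 * (r + n.+1)%:R <= expR (delta * L),
      8 * k%:R <= expR (L / 2) /\ 8 <= expR L &
      (delta * L + (L + delta * L)) *
        ((L + delta * L + C) ^+ 2 / (s2 * n.+1%:R)) <= delta * L / 2].
Proof.
move=> C0 s0 d0; have d0' := ltW d0; have s0' := ltW s0.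
have r0 : 0 <= r%:R :> R by [].
have k0 : 0 <= k%:R :> R by [].
(* Equality case of the last inequality, with [K * L ^+ 2] as block length and [C] replaced by
   [C * L]. *)
have [K K0 KE] : exists2 K, 0 <= K &
    K * (delta * s2) = 2 * ((1 + 2 * delta) * (1 + delta + C) ^+ 2).
  exists (2 * ((1 + 2 * delta) * (1 + delta + C) ^+ 2) / (delta * s2)).
    by rewrite divr_ge0 ?mulr_ge0 ?sqr_ge0 ?addr_ge0 ?mulr_ge0.
  by rewrite divfK// mulf_neq0 ?gt_eqF.
(* The factor 27 comes from [(y / 3) ^+ 3 <= expR y] at [y = delta * L]; this cube absorbs the
   [L ^+ 2] in the block length. *)
have [L [L1 LC LD Lk]] : exists L, [/\ 1 <= L, C * r%:R <= delta * L,
    16 * 27 * (r%:R + 2 + K) <= L * delta ^+ 3 & 16 * k%:R + 16 <= L].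
  have large (x y : R) : 0 <= x -> 0 < y -> exists2 l, 0 <= l & x <= l * y.
    by move=> x0 y0; exists (x / y); rewrite ?divr_ge0 ?divfK ?gt_eqF// ltW.
  have [B B0 HB] := large _ _ (mulr_ge0 C0 r0) d0.
  have D30 : 0 < delta ^+ 3 by exact: exprn_gt0.
  have X0 : 0 <= 16 * 27 * (r%:R + 2 + K) by lra.
  have [D D0 HD] := large _ _ X0 D30.
  exists (B + D + 16 * k%:R + 16); split.
  - lra.
  - rewrite [leRHS]mulrC; apply: (le_trans HB); rewrite ler_wpM2r//; lra.
  - apply: (le_trans HD); rewrite ler_wpM2r ?(ltW D30)//; lra.
  - lra.
have L0 : 0 < L by lra.
have L0' := ltW L0.
have LL : L <= L ^+ 2 by rewrite expr2 ler_peMl.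
have L21 : 1 <= L ^+ 2 by lra.
have KL0 : 0 <= K * L ^+ 2 by rewrite mulr_ge0 ?sqr_ge0.
pose n := Num.truncn (K * L ^+ 2).
have /andP[nle ngt] : n%:R <= K * L ^+ 2 < n.+1%:R by exact: truncn_itv.
clearbody n.
exists (L, n) => /=; split => //.
- apply: (@le_trans _ _ ((delta * L / 3) ^+ 3)); last first.
    rewrite -[in leRHS](divfK (_ : 3 != 0) (delta * L))// expRM_natr.
    rewrite lerXn2r ?nnegrE ?expR_ge0 ?divr_ge0 ?mulr_ge0//.
    by apply: le_trans (expR_ge1Dx _); rewrite lerDr.
  have hL := ler_wpM2r (sqr_ge0 L) LD.
  have rL : r%:R <= r%:R * L ^+ 2 by rewrite ler_peMr.
  rewrite natrD -natr1.
  have -> : (delta * L / 3) ^+ 3 = L * delta ^+ 3 * L ^+ 2 / 27 by field.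
  lra.
- by split; apply: le_trans (expR_ge1Dx _); lra.
- have n0 : 0 < n.+1%:R :> R by rewrite ltr0n.
  rewrite mulrA ler_pdivrMr ?mulr_gt0//.
  have h0 : L + delta * L + C <= (1 + delta + C) * L.
    by rewrite !mulrDl mul1r lerD2l ler_peMr.
  have h1 : (L + delta * L + C) ^+ 2 <= ((1 + delta + C) * L) ^+ 2.
    have h2 : 0 <= L + delta * L + C by rewrite !addr_ge0// mulr_ge0.
    by rewrite lerXn2r ?nnegrE// (le_trans h2).
  apply: (@le_trans _ _ ((1 + 2 * delta) * L * ((1 + delta + C) * L) ^+ 2)).
    rewrite (_ : delta * L + (L + delta * L) = (1 + 2 * delta) * L); last by ring.
    by rewrite ler_wpM2l// mulr_ge0// addr_ge0// mulr_ge0.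
  apply: (@le_trans _ _ (delta * L / 2 * (s2 * (K * L ^+ 2)))).
    rewrite (_ : delta * L / 2 * (s2 * (K * L ^+ 2)) = K * (delta * s2) * L ^+ 3 / 2).
      by rewrite KE le_eqVlt; apply/orP; left; apply/eqP; field.
    by field.
  by rewrite ler_wpM2l ?divr_ge0 ?mulr_ge0// ler_wpM2l// ltW.
Qed.

(** * Recurrence along valley scales *)

(** Restricts a sum to even times: [f j] will stand for time [j.+1]. *)
Lemma sum_double_ge (R : realType) (f : nat -> R) N : (forall j, 0 <= f j) ->
  \sum_(m < N) f m.*2.+1 <= \sum_(j < N.*2) f j.
Proof.
move=> f0; elim: N => [|N IH]; first by rewrite !big_ord0.
rewrite doubleS !big_ord_recr/=; apply: lerD => //.
by rewrite (le_trans IH)// lerDl.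
Qed.

(* With [delta = 1 / (6 d)], the [expR L / 8] even times up to [expR L / 2] each
   contribute at least [expR (- 3 delta L)] to the power [d]. *)
Lemma sum_return_prob_large (R : realType) (d : nat) (w : 'I_d -> int -> R)
    (C L delta : R) (r n k : nat) :
  (0 < d)%N -> delta = (6 * d%:R)^-1 ->
  (forall i x, 0 <= w i x <= 1) ->
  C * r%:R <= delta * L -> 16 * (r + n)%:R <= expR (delta * L) ->
  8 * k%:R <= expR (L / 2) -> 8 <= expR L ->
  (forall i N, 4 * N%:R <= expR (L + delta * L - C * r%:R) ->
    (16 * (r + n)%:R * expR (C * r%:R + delta * L))^-1 <= return_prob (w i) N.*2) ->
  (0 < r + n)%N ->
  exists N, k%:R <= \sum_(j < N) \prod_i return_prob (w i) j.+1.
Proof.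
move=> d0 deltaE w01 Cr rn ke e8 ret rn0.
have E0 := expR_gt0 L; pose N := Num.truncn (expR L / 4).
have /andP[Nle Ngt] : N%:R <= expR L / 4 < N.+1%:R.
  by apply: truncn_itv; rewrite divr_ge0// ltW.
have ret0 i j : 0 <= return_prob (w i) j by apply: iter_step_op_ge0.
have u0 j : 0 <= \prod_i return_prob (w i) j.+1 by exact: prodr_ge0.
exists N.*2; apply: le_trans (sum_double_ge N u0).
pose q := expR (- (3 * (delta * L))).
have q0 : 0 < q := expR_gt0 _.
apply: (@le_trans _ _ (\sum_(m < N) q ^+ d)); last first.
  apply: ler_sum => m _; rewrite -[X in q ^+ X]card_ord -prodr_const.
  apply: ler_prod => i _; rewrite ltW//=; rewrite -doubleS.
  apply: le_trans (ret i m.+1 _).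
    rewrite -[q]invrK lef_pV2 ?posrE ?invr_gt0 ?mulr_gt0 ?expR_gt0 ?ltr0n//.
    rewrite /q -expRN opprK.
    (* One factor [expR (delta * L)] pays for [16 * (r + n)], the other two for the exponent
       [C * r + delta * L]. *)
    apply: (@le_trans _ _ (expR (delta * L) * expR (2 * (delta * L)))).
      by rewrite ler_pM ?mulr_ge0 ?expR_ge0 ?ler_expR//; lra.
    by rewrite -expRD ler_expR; lra.
  apply: (@le_trans _ _ (expR L)); last by rewrite ler_expR; lra.
  have : m.+1%:R <= N%:R :> R by rewrite ler_nat.
  by lra.
rewrite sumr_const card_ord -[leRHS]mulr_natl.
have qE : q ^+ d = expR (- (L / 2)).
  rewrite /q -expRM_natr; congr expR; rewrite deltaE; field.
  by rewrite pnatr_eq0 -lt0n.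
rewrite qE; apply: (@le_trans _ _ (expR L / 8 * expR (- (L / 2)))).
  rewrite mulrAC -expRD (_ : L - L / 2 = L / 2); last by lra.
  by lra.
(* As [expR L] is at least 8, truncation loses at most half of [expR L / 4]. *)
by rewrite ler_wpM2r ?expR_ge0//; move: Ngt; rewrite -[N.+1%:R]natr1; lra.
Qed.

Theorem corollary6p3 (R : realType) (d : nat)
  (P : probability (environment R) R)
  (Pd : probability (d.-tuple (environment R)) R)
  (d_gt0 : (0 < d)%N)
  (P_iid : iid_environment_law P)
  (E_log_rho : ('E_P[fun w => ln (rho w 0)] = 0)%E)
  (elliptic : exists eps : R, 0 < eps < 1 / 2 /\
     P [set w : environment R | eps <= w 0 <= 1 - eps] = 1%E)
  (V_log_rho : (0 < 'V_P[fun w => ln (rho w 0)])%E)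
  (Pd_law : is_product_law P Pd) :
  {ae Pd, forall w : d.-tuple (environment R),
    forall (disp : measure_display) (T : measurableType disp)
      (Q : probability T R) (X : 'I_d -> nat -> {RV Q >-> int}),
      (forall i, is_walk_in_environment (tnth w i) (X i)) ->
      independent_processes X ->
      recurrent X}.
Proof.
have [eps [/andP[eps_gt0 eps_lt] ell]] := elliptic.
have eps_lt1 : eps < 1 by lra.
pose C := - ln eps.
have C0 : 0 <= C by rewrite oppr_ge0 ln_le0// ltW.
pose s2 := Ex P (fun w => tlog eps (w 0) ^+ 2).
have s20 : 0 < s2 by exact: Ex_tlog_sqr_gt0.
pose delta : R := (6 * d%:R)^-1.
have delta0 : 0 < delta by rewrite invr_gt0 mulr_gt0// ltr0n.
have [scale scaleP] := choice (fun rk : nat * nat => exists_scale rk.1 rk.2 C0 s20 delta0).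
(* [rad k] counts the sites on each side that belong to scales below [k]. *)
pose rad := fix rad k := if k is k'.+1 then
  (rad k' + (scale (rad k', k')).2.+1)%N else 0%N.
pose L k := (scale (rad k, k)).1; pose n k := (scale (rad k, k)).2.
(* The extra [delta * L] in [b] compensates the shift caused by the smaller scales, so the climb
   still reaches [L]. *)
pose a k := delta * L k; pose b k := L k + delta * L k.
(* Site 0 belongs to the left: its log-ratio gives the increment between 0 and -1. *)
pose eR k j : int := (rad k + j).+1%:Z; pose eL k j : int := - (rad k + j)%N%:Z.
pose GR k := block_event eps (eR k) 1 (a k) (b k) (n k).+1.
pose GL k := block_event eps (eL k) (-1) (a k) (b k) (n k).+1.
pose G k := GR k `&` GL k.
pose SR k := block_sites (eR k) (n k).+1; pose SL k := block_sites (eL k) (n k).+1.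
have rad_mono k l : (k < l)%N -> (rad k + (n k).+1 <= rad l)%N.
  elim: l => // l IH; rewrite ltnS leq_eqVlt => /predU1P[->//|/IH h].
  by apply: leq_trans h _; exact: leq_addr.
have sG k : sites_sigma (SR k `|` SL k) (G k).
  apply: (@measurableI _ (g_sigma_algebraType (@site_cylinders R (SR k `|` SL k)))).
    by apply: (@sites_sigmaS R (SR k)); [exact: subsetUl|exact: block_event_sigma].
  by apply: (@sites_sigmaS R (SL k)); [exact: subsetUr|exact: block_event_sigma].
have mG k : measurable (G k) := sites_sigma_measurable (sG k).
have disj_lt k l : (k < l)%N -> (SR k `|` SL k) `&` (SR l `|` SL l) = set0.
  move=> /rad_mono; clear -rad eR eL SR SL => kl; apply/seteqP; split=> // x [].
  by move=> [] [i /= ik <-] [] [j /= jl]; rewrite /eR /eL; move: ik jl; lia.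
have disj k l : k <> l -> (SR k `|` SL k) `&` (SR l `|` SL l) = set0.
  by move=> /eqP; rewrite neq_ltn => /orP[/disj_lt//|/disj_lt]; rewrite setIC.
have [_ indep _] := P_iid.
(* Gambler's ruin gives at least [(a / 2) / (a + b + C)]; bounding [C] by [C * L] makes [L]
   cancel. *)
pose p := delta / 2 / (1 + 2 * delta + C).
have den0 : 0 < 1 + 2 * delta + C by lra.
have p0 : 0 < p by rewrite divr_gt0// divr_gt0.
have blockp (e : nat -> int) (sgn : R) k : injective e -> sgn ^+ 2 = 1 ->
    p <= fine (P (block_event eps e sgn (a k) (b k) (n k).+1)).
  move=> e_inj sgn1; have [L1 _ _ _ hq] := scaleP (rad k, k).
  rewrite -/(L k) -/(n k) in L1 hq.
  have a0 : 0 < a k by rewrite mulr_gt0//; lra.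
  have ab : a k <= b k by rewrite /b /a; lra.
  have := block_event_prob P_iid eps_gt0 eps_lt1 ell E_log_rho V_log_rho
    e_inj sgn1 (n k) a0 ab.
  rewrite -/s2 -/C => h.
  set F := fine _ in h *.
  have F0 : 0 <= F by exact: fine_ge0.
  have h2 : a k / 2 <= (a k + b k + C) * F.
    apply: le_trans h; move: hq; rewrite -/(b k) -/(a k).
    by move: (_ * (_ / _)) => Y; lra.
  rewrite /p ler_pdivrMr//.
  have L0 : 0 < L k by lra.
  rewrite -(ler_pM2r L0); apply: (@le_trans _ _ (a k / 2)); first by rewrite /a; lra.
  apply: (le_trans h2); rewrite mulrC -mulrA ler_wpM2l// /a /b.
  by have := ler_peMr C0 L1; lra.
have pG k : p ^+ 2 <= fine (P (G k)).
  have -> : P (G k) = (P (GR k) * P (GL k))%E.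
    apply: (@sites_sigma_indep _ P indep (SR k) (SL k)).
    - clear -rad eR eL SR SL; apply/seteqP; split=> // x [[i /= ik <-]].
      by move=> [j /= jl]; rewrite /eR /eL; move: ik jl; lia.
    - exact: block_event_sigma.
    - exact: block_event_sigma.
  have mGR : measurable (GR k) 
    by apply: (@sites_sigma_measurable R (SR k)); exact: block_event_sigma.
  have mGL : measurable (GL k) 
    by apply: (@sites_sigma_measurable R (SL k)); exact: block_event_sigma.
  rewrite fineM ?fin_num_measure// expr2 ler_pM ?(ltW p0)//; apply: blockp.
  - by clear => i j []; lia.
  - by rewrite expr1n.
  - by clear => i j; rewrite /eL; lia.
  - by rewrite sqrrN expr1n.
have mtup (A : set (environment R)) : measurable A ->
    measurable [set t : d.-tuple (environment R) | forall i, A (tnth t i)].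
  move=> mA; rewrite (_ : [set t | _] =
      \bigcap_i (fun t : d.-tuple (environment R) => tnth t i) @^-1` A).
    apply: fin_bigcap_measurable => // i _.
    by rewrite -[X in measurable X]setTI; exact: measurable_tnth.
  by apply/seteqP; split=> t ht i; [move=> _|]; exact: ht.
pose E k := [set t : d.-tuple (environment R) | forall i, G k (tnth t i)].
(* All [d] environments have a valley at scale [k] with probability at least [(p ^+ 2) ^+ d],
   independently over [k]. *)
have BC : Pd.-negligible [set t | ~ forall m, exists2 k, (m <= k)%N & E k t].
  apply: (@second_borel_cantelli _ _ _ Pd E
    (fun k => fine (P (G k)) ^+ d) ((p ^+ 2) ^+ d)).
  - by move=> k; exact: mtup.
  - move=> s us; rewrite /pr.
    pose Gs := [set w : environment R | forall k, k \in s -> G k w].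
    have -> : [set t | forall k, k \in s -> E k t] =
       [set t : d.-tuple (environment R) | forall i, Gs (tnth t i)].
      by apply/seteqP; split=> t /= h => [i k ks|k ks i]; exact: h.
    have mI : measurable Gs.
      rewrite (_ : Gs = \bigcap_(k in [set` s]) G k); last by apply/seteqP; split.
      exact: bigcap_measurableType.
    rewrite (Pd_law (fun=> Gs))// (sites_sigma_mutual_indep indep disj sG us).
    have -> : (\prod_(k <- s) P (G k) = (\prod_(k <- s) fine (P (G k)))%:E)%E.
      by rewrite -prodEFin; apply: eq_bigr => k _; rewrite fineK// fin_num_measure.
    by rewrite prodEFin prodr_const card_ord /= prodrXl.
  - by rewrite !exprn_gt0.
  - by move=> k; rewrite lerXn2r ?nnegrE ?fine_ge0// exprn_ge0// ltW.
(* On [W] the truncated log-ratio is the true one at every site. *)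
pose W := [set w : environment R | forall x, eps <= w x <= 1 - eps].
have mW : measurable W by exact: elliptic_sites_measurable.
pose WW := [set t : d.-tuple (environment R) | forall i, W (tnth t i)].
have WW1 : Pd (~` WW) = 0%E.
  rewrite probability_setC; last exact: mtup.
  rewrite (Pd_law (fun=> W))// big1 ?subee// => i _; exact: elliptic_sites.
have nW : Pd.-negligible (~` WW).
  by apply/negligibleP => //; apply: measurableC; exact: mtup.
apply: negligibleS (negligibleU BC nW) => t /= nrec.
apply: contrapT => /not_orP[/contrapT io /contrapT tW]; apply: nrec.
move=> disp T Q X Xw Xind; apply: (recurrent_of_unbounded_sum Xw Xind) => K.
have [k Kk] : exists k : nat, K <= k%:R.
  by exists (Num.truncn `|K|).+1; rewrite (le_trans (ler_norm _))// ltW// truncnS_gt.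
(* Scale [l] was chosen to make the sum of return probabilities at least [l], hence at least [K]. *)
have [l kl El] := io k.
have [L1 Cr rn [ke e8] _] := scaleP (rad l, l).
rewrite -/(L l) -/(n l) /= in L1 Cr rn ke e8.
have w01 i x : 0 < tnth t i x < 1.
  by have /andP[h1 h2] := tW i x; apply/andP; split; lra.
have lrE i x : log_ratio (tnth t i) x = tlog eps (tnth t i x) by rewrite tlogE//; exact: tW.
have lrC i x : `|log_ratio (tnth t i) x| <= C by rewrite lrE tlog_bound.
have w01' i x : 0 <= tnth t i x <= 1.
  by have /andP[h1 h2] := w01 i x; rewrite !ltW.
have [||N HN] := @sum_return_prob_large R d (fun i => tnth t i) C (L l) delta (rad l)
  (n l).+1 l d_gt0 erefl w01' Cr rn ke e8.
- move=> i N; have [GRi GLi] := El i.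
  have L0 : 0 < L l by lra.
  have a0 : 0 < a l by exact: mulr_gt0.
  have b0 : 0 < b l by rewrite /b; apply: addr_gt0.
  apply: (@valley_return_prob _ (tnth t i) C (w01 i) (lrC i)).
  + exact: ltW.
  + by apply: (le_lt_trans Cr); rewrite ltrDr.
  + have [j [jn bj ja]] := stopped_exit a0 b0 GRi.
    have SE m : \sum_(q < m) block_step eps (eR l) 1 q (tnth t i) =
        \sum_(q < m) log_ratio (tnth t i) (rad l + q).+1%:Z.
      by apply: eq_bigr => q _; rewrite lrE /block_step mul1r.
    by exists j; split=> [//||m mj]; rewrite -SE//; exact: ja.
  + have [j [jn bj ja]] := stopped_exit a0 b0 GLi.
    have SE m : \sum_(q < m) block_step eps (eL l) (-1) q (tnth t i) =
        \sum_(q < m) - log_ratio (tnth t i) (- (rad l + q)%N%:Z).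
      by apply: eq_bigr => q _; rewrite lrE /block_step mulN1r.
    by exists j; split=> [//||m mj]; rewrite -SE//; exact: ja.
- by rewrite addnS.
exists N; apply: le_trans HN; apply: (le_trans Kk).
by rewrite ler_nat.
Qed.
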